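(* Let $\sigma>0$, $c>0$, $B\ge0$ and $0\le b\le c$. Let $\{\theta^n\}_{n=1}^\infty$ be a sequence of vectors with $\theta^n\in\mathbb R^n$ and $\|\theta^n\|^2/n=b^2$ for every $n$. For each $n$ let $X^n\sim\mathcal N(\theta^n,\sigma^2I_n)$ and let $M_n\in\mathcal M^*_{n,B,\sigma,c}$ be the random quantized estimator described in the context, with random codebook independent of $X^n$. Then there is a constant $C$, not depending on $n$ (but possibly depending on $b$, $\sigma$ and $B$), such that, as $n\to\infty$, $$\mathbb P\left(d(\theta^n,M_n(X^n))>\frac{\sigma^2b^2}{\sigma^2+b^2}+\frac{b^4}{\sigma^2+b^2}2^{-2B}+C\sqrt{\frac{\log n}{n}}\right)\longrightarrow 0,$$ where the probability is with respect to both the random codebook defining $M_n$ and $X^n$.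
   Context: For $u,v\in\mathbb R^n$, $d(u,v)=\frac1n\|u-v\|^2$, with $\|\cdot\|$ the Euclidean norm. The random quantized estimator $M_n\in\mathcal M^*_{n,B,\sigma,c}$ is defined as follows. (1) Codebooks: $\mathcal B=\{1/\sqrt n,2/\sqrt n,\dots,\lceil c^2\sqrt n\rceil/\sqrt n\}$, and $\mathcal X$ consists of $2^{nB}$ (integer part, if not an integer) i.i.d. random vectors uniformly distributed on the unit sphere $\mathbb S^{n-1}\subset\mathbb R^n$. (2) Encoding: put $\hat b^2=\frac1n\|X^n\|^2-\sigma^2$ (a real number, possibly negative); let $\check b^2$ be the element of $\mathcal B$ minimizing $|\beta-\hat b^2|$ over $\beta\in\mathcal B$, and let $\check X^n$ be the element of $\mathcal X$ maximizing $\langle X^n,x^n\rangle$ over $x^n\in\mathcal X$ (ties broken arbitrarily). The indices of these elements are stored or transmitted. (3) Decoding: the estimate is $$M_n(X^n)=\check\theta^n=\sqrt{\frac{n\,\check b^4(1-2^{-2B})}{\check b^2+\sigma^2}}\;\check X^n,\qquad \check b^4=(\check b^2)^2.$$ $\mathcal M^*_{n,B,\sigma,c}$ denotes the ensemble of such quantizers, identified with the set of possible codebooks $(\mathbb S^{n-1})^{2^{nB}}$ and given the product uniform probability measure. *)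

(* Defs.v *)
From HB Require Import structures.
From mathcomp Require Import all_boot all_order all_algebra.
From mathcomp Require Import all_classical all_reals all_analysis.

Set Implicit Arguments.
Unset Strict Implicit.
Unset Printing Implicit Defensive.

Import Order.TTheory GRing.Theory Num.Theory.
Import numFieldNormedType.Exports.

Local Open Scope classical_set_scope.
Local Open Scope ring_scope.

(* R^n is n.-tuple R, which the library equips with the product of the Borel
   sigma-algebras; matrices carry no measurable structure, and the library's
   norm on them is the sup norm. *)
Section euclidean.
Context {R : realType} {n : nat}.
Implicit Types x y : n.-tuple R.

Definition inner x y : R := \sum_(i < n) tnth x i * tnth y i.

Definition enorm x : R := Num.sqrt (inner x x).

Definition vsub x y : n.-tuple R := [tuple tnth x i - tnth y i | i < n].

Definition vscale (a : R) x : n.-tuple R := [tuple a * tnth x i | i < n].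

Definition mxact (Q : 'M[R]_n) x : n.-tuple R :=
  [tuple \sum_(j < n) Q i j * tnth x j | i < n].

Definition dist x y : R := n%:R^-1 * enorm (vsub x y) ^+ 2.

Definition unit_sphere : set (n.-tuple R) := [set x | enorm x = 1].

End euclidean.

Section laws.
Context {R : realType}.

(* mu is the product of the laws nu i.  A probability measure on n.-tuple T is
   determined by its values on boxes. *)
Definition product_law d (T : measurableType d) n (nu : 'I_n -> set T -> \bar R)
    (mu : set (n.-tuple T) -> \bar R) : Prop :=
  forall A : 'I_n -> set T, (forall i, measurable (A i)) ->
    mu [set x | forall i, A i (tnth x i)] = (\prod_(i < n) nu i (A i))%E.

(* N(theta, sigma^2 I_n).  normal_prob takes the standard deviation. *)
Definition gaussian_law n (theta : n.-tuple R) (sigma : R)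
    (mu : set (n.-tuple R) -> \bar R) : Prop :=
  product_law (fun i => normal_prob (tnth theta i) sigma) mu.

(* The uniform distribution on the unit sphere is the rotation-invariant
   probability measure on it. *)
Definition uniform_sphere_law n (nu : probability (n.-tuple R) R) : Prop :=
  nu unit_sphere = 1%E /\
  forall Q : 'M[R]_n, Q *m Q^T = 1%:M ->
  forall A : set (n.-tuple R), measurable A -> nu (mxact Q @^-1` A) = nu A.

Definition codebook_law N n (mu : set (N.-tuple (n.-tuple R)) -> \bar R) : Prop :=
  exists2 nu : probability (n.-tuple R) R,
    uniform_sphere_law nu & product_law (fun=> nu) mu.

Definition independent_rv d d1 d2 (T : measurableType d)
    (T1 : measurableType d1) (T2 : measurableType d2) (P : probability T R)
    (X : {RV P >-> T1}) (Y : {RV P >-> T2}) : Prop :=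
  forall (A1 : set T1) (A2 : set T2), measurable A1 -> measurable A2 ->
    P (X @^-1` A1 `&` Y @^-1` A2) = (P (X @^-1` A1) * P (Y @^-1` A2))%E.

End laws.

Section quantizer.
Context {R : realType}.
Implicit Types (B sigma c : R) (n : nat).

Definition codebook_size n B : nat := Num.truncn (2 `^ (n%:R * B)).

Definition scalar_codebook n c : set R :=
  [set k%:R / Num.sqrt n%:R | k in
    [set k : nat | (0 < k)%N /\ k%:Z <= Num.ceil (c ^+ 2 * Num.sqrt n%:R)]].

Definition bhat2 n sigma (x : n.-tuple R) : R :=
  n%:R^-1 * enorm x ^+ 2 - sigma ^+ 2.

Definition scalar_encoding (BB : set R) (t beta : R) : Prop :=
  BB beta /\ forall beta', BB beta' -> `|beta - t| <= `|beta' - t|.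

Definition vector_encoding n N (XX : N.-tuple (n.-tuple R)) (x : n.-tuple R)
    (j : 'I_N) : Prop :=
  forall j' : 'I_N, inner x (tnth XX j') <= inner x (tnth XX j).

Definition decode n B sigma (bcheck2 : R) (xcheck : n.-tuple R) : n.-tuple R :=
  vscale (Num.sqrt (n%:R * bcheck2 ^+ 2 * (1 - 2 `^ (- (2 * B))) /
                    (bcheck2 + sigma ^+ 2)))
         xcheck.

(* m is the estimate obtained from the data x and the codebook XX for some way
   of breaking the ties in the two encodings. *)
Definition quantized_estimate n N B sigma c (XX : N.-tuple (n.-tuple R))
    (x m : n.-tuple R) : Prop :=
  exists bcheck2 : R, exists j : 'I_N,
    [/\ scalar_encoding (scalar_codebook n c) (bhat2 sigma x) bcheck2,
        vector_encoding XX x j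
      & m = decode B sigma bcheck2 (tnth XX j)].

End quantizer.

(* Main.v *)
(* With X = theta + sigma Z and r = 2^{-2B}, the squared error of the estimate
   alpha v, v being the selected codeword and a = alpha / sqrt n, is
   b^2 + a^2 - 2 a <theta, v> / sqrt n.  By Chebyshev's inequality |X|^2 / n and
   <theta, X> / n concentrate around b^2 + sigma^2 and b^2 at scale
   lambda = sqrt (log n / n), which controls a and <theta, X> / |X|.

   Along X: the moments of a coordinate of a uniform point on the sphere obey
   an exact recursion, forced by rotation invariance, and tilting the law by a
   high even power of the coordinate gives a lower bound on the mass of the cap
   of height t = sqrt (1 - r) - O(1 / sqrt n) that, multiplied by the number
   2^{nB} of codewords, tends to infinity; so some codeword has
   <X, v> >= t |X|.

   Across X: rotation invariance around X makes the mean square of the selected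
   codeword along any direction orthogonal to X at most 1 / (n - 1), once ties
   are known to be negligible; so the component of theta orthogonal to X
   contributes at most lambda to <theta, v> / sqrt n.

   On the intersection of these events the error is at most
   b^2 - (1 - r) b^4 / (b^2 + sigma^2) + C lambda, and the complement has
   probability O(1 / log n). *)

Require Import Defs.
From HB Require Import structures.
From mathcomp Require Import all_boot all_order all_algebra.
From mathcomp Require Import all_classical all_reals all_analysis.
From mathcomp Require Import perm measurable_realfun zify ring lra.

Set Implicit Arguments.
Unset Strict Implicit.
Unset Printing Implicit Defensive.

Import Order.TTheory GRing.Theory Num.Theory.
Import numFieldNormedType.Exports.

Local Open Scope classical_set_scope.
Local Open Scope ring_scope.

(** * Euclidean geometry *)

(** The uniform law on the sphere is known only through rotation invariance, with no density at
    hand, so the mass of a cap is not computed as an integral: moments take its place, and one term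
    of a binomial expansion takes the place of Stirling's formula. The delicate point is that the
    cap mass must beat 2^{-nB} although every estimate loses polynomial factors and the Chebyshev
    window of the tilted law costs a factor exponential in sqrt n. Giving up a height of order 1 /
    sqrt n multiplies the mass by a larger exponential in sqrt n, which pays for all of this; and 1
    / sqrt n is below lambda, so only the constant C is affected. Ties may be broken in any way, so
    the selected codeword is not a given measurable function of the data. The bad events therefore
    quantify over all maximisers, and only strict maximisers, whose events are disjoint, carry
    integrals. Independence is used by freezing X at a value x: the codebook bounds are uniform in
    x, including x = 0. The case B = 0 is apart, since the cap argument needs 2^{-2B} < 1. *)

Section euclidean_space.
Context {R : realType} {n : nat}.
Implicit Types (x y u v a b : n.-tuple R) (Q : 'M[R]_n) (i j : 'I_n).

Lemma innerC x y : inner x y = inner y x.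
Proof. by apply: eq_bigr => i _; rewrite mulrC. Qed.

Lemma inner_ge0 x : 0 <= inner x x.
Proof. by apply: sumr_ge0 => i _; rewrite -expr2 sqr_ge0. Qed.

Lemma inner_eq0 x : inner x x = 0 -> forall i, tnth x i = 0.
Proof.
move=> /eqP; rewrite /inner psumr_eq0 => [/allP x0 i|i _]; last first.
  by rewrite -expr2 sqr_ge0.
by have /implyP/(_ isT) := x0 i (mem_index_enum _); rewrite mulf_eq0 orbb => /eqP.
Qed.

Lemma enorm_sqr x : enorm x ^+ 2 = inner x x.
Proof. by rewrite sqr_sqrtr// inner_ge0. Qed.

Lemma enorm_ge0 x : 0 <= enorm x.
Proof. exact: sqrtr_ge0. Qed.

Lemma inner_vsubl x y v : inner (vsub x y) v = inner x v - inner y v.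
Proof. by rewrite -sumrB; apply: eq_bigr => i _; rewrite tnth_mktuple mulrBl. Qed.

Lemma inner_vsubr v x y : inner v (vsub x y) = inner v x - inner v y.
Proof. by rewrite innerC inner_vsubl !(innerC v). Qed.

Lemma inner_vscalel k x v : inner (vscale k x) v = k * inner x v.
Proof. by rewrite mulr_sumr; apply: eq_bigr => i _; rewrite tnth_mktuple mulrA. Qed.

Lemma inner_vscaler k v x : inner v (vscale k x) = k * inner v x.
Proof. by rewrite innerC inner_vscalel innerC. Qed.

Definition inner_simp := (inner_vsubl, inner_vsubr, inner_vscalel, inner_vscaler).

Lemma cauchy_schwarz x y : inner x y ^+ 2 <= inner x x * inner y y.
Proof.
have := inner_ge0 (vsub (vscale (inner y y) x) (vscale (inner x y) y)).
have [y0 _|y0] := eqVneq (inner y y) 0.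
  suff -> : inner x y = 0 by rewrite expr0n/= mulr_ge0// inner_ge0.
  by apply: big1 => i _; rewrite (inner_eq0 y0) mulr0.
have yp : 0 < inner y y by rewrite lt_def y0 inner_ge0.
rewrite !inner_simp (innerC y x) => h.
rewrite -(ler_pM2l yp) -subr_ge0; apply: le_trans h _.
by rewrite le_eqVlt; apply/orP; left; apply/eqP; ring.
Qed.

Definition ebase i : n.-tuple R := [tuple (k == i)%:R | k < n].

Lemma inner_ebasel i x : inner (ebase i) x = tnth x i.
Proof.
rewrite /inner (bigD1 i)//= tnth_mktuple eqxx mul1r big1 ?addr0// => j ji.
by rewrite tnth_mktuple (negbTE ji) mul0r.
Qed.

Lemma inner_ebase i j : inner (ebase i) (ebase j) = (i == j)%:R.
Proof. by rewrite inner_ebasel tnth_mktuple. Qed.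

Lemma inner_mxact Q x y : Q *m Q^T = 1%:M ->
  inner (mxact Q x) (mxact Q y) = inner x y.
Proof.
move=> /mulmx1C QQ; pose c z : 'cV[R]_n := \col_i tnth z i.
have cQ z : c (mxact Q z) = Q *m c z.
  apply/colP => i; rewrite !mxE tnth_mktuple.
  by apply: eq_bigr => j _; rewrite mxE.
have E z w : inner z w = ((c z)^T *m c w) 0 0.
  by rewrite mxE; apply: eq_bigr => i _; rewrite !mxE.
by rewrite !E !cQ trmx_mul -mulmxA (mulmxA Q^T) QQ mul1mx.
Qed.

Lemma mxactM Q1 Q2 x : mxact (Q1 *m Q2) x = mxact Q1 (mxact Q2 x).
Proof.
apply/eq_from_tnth => i; rewrite !tnth_mktuple.
under [RHS]eq_bigr do rewrite tnth_mktuple mulr_sumr.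
rewrite exchange_big/=; apply: eq_bigr => j _; rewrite mxE mulr_suml.
by apply: eq_bigr => k _; rewrite mulrA.
Qed.

Lemma mxact_vscale Q k x : mxact Q (vscale k x) = vscale k (mxact Q x).
Proof.
apply/eq_from_tnth => i; rewrite !tnth_mktuple mulr_sumr.
by apply: eq_bigr => j _; rewrite tnth_mktuple mulrCA.
Qed.

(* At u = 0 the junk value 2 / 0 = 0 makes this the identity, so no case
   distinction is needed. *)
Definition householder u : 'M[R]_n :=
  1%:M - (2 / inner u u) *: ((\col_i tnth u i) *m (\row_i tnth u i)).

Lemma householder_orthogonal u : householder u *m (householder u)^T = 1%:M.
Proof.
rewrite /householder; set c := 2 / _; set C := \col_i _; set r := \row_i _.
have CT : C^T = r by apply/rowP => i; rewrite !mxE.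
have rT : r^T = C by rewrite -CT trmxK.
have rC : r *m C = (inner u u)%:M.
  apply/rowP => i; rewrite !mxE (ord1 i) eqxx mulr1n.
  by apply: eq_bigr => k _; rewrite !mxE.
have -> : (1%:M - c *: (C *m r))^T = 1%:M - c *: (C *m r).
  by rewrite [LHS]raddfB/= trmx1 [X in _ - X]linearZ/= trmx_mul CT rT.
rewrite mulmxBl mul1mx mulmxBr mulmx1 -scalemxAl -scalemxAr -mulmxA.
rewrite (mulmxA r) rC mul_scalar_mx -scalemxAr.
rewrite !scalerA.
have -> : c * (c * inner u u) = c + c.
  rewrite /c; have [->|u0] := eqVneq (inner u u) 0; first by rewrite invr0; ring.
  by field.
by rewrite scalerDl opprB addrK subrK.
Qed.

Lemma mxact_householder u x :
  mxact (householder u) x = vsub x (vscale (2 / inner u u * inner u x) u).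
Proof.
apply/eq_from_tnth => i; rewrite !tnth_mktuple.
have H j : householder u i j * tnth x j =
    (i == j)%:R * tnth x j - 2 / inner u u * tnth u i * (tnth u j * tnth x j).
  by rewrite !mxE big_ord1 !mxE; ring.
under eq_bigr do rewrite H.
rewrite sumrB -mulr_sumr -/(inner u x) (bigD1 i)//= eqxx mul1r big1 ?addr0.
  by rewrite mulrAC.
by move=> j ji; rewrite eq_sym (negbTE ji) mul0r.
Qed.

(** Equal norms give <u, u> = 2 <u, a> for [u = a - b], so the reflection subtracts exactly [u] from
    [a]. If [u] vanishes, [a] and [b] agree already. *)
Lemma householder_swap a b : inner a a = inner b b ->
  mxact (householder (vsub a b)) a = b.
Proof.
move=> ab; rewrite mxact_householder; set u := vsub a b.
have uu : inner u u = 2 * inner u a.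
  by rewrite /u !inner_simp ab (innerC b a); ring.
apply/eq_from_tnth => i; rewrite !tnth_mktuple.
have [u0|u0] := eqVneq (inner u u) 0.
  have := inner_eq0 u0 i; rewrite tnth_mktuple => /subr0_eq ->.
  by rewrite subrr mulr0 subr0.
have ->: 2 / inner u u * inner u a = 1.
  by rewrite mulrAC -uu divff.
by rewrite mul1r opprB addrCA subrr addr0.
Qed.

Lemma householder_id u x : inner u x = 0 -> mxact (householder u) x = x.
Proof.
move=> ux; rewrite mxact_householder ux mulr0.
by apply/eq_from_tnth => i; rewrite !tnth_mktuple mul0r subr0.
Qed.

(** Two reflections: one sends [x] to the axis [i]; the mirror of the other contains that axis, so
    it can move [v] without disturbing it. Since [v] may vanish, the lemma also rotates a single
    vector. *)
Lemma rotation_to_frame x v i j : i != j -> inner x x != 0 -> inner x v = 0 ->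
  exists2 Q : 'M[R]_n, Q *m Q^T = 1%:M &
    mxact Q x = vscale (enorm x) (ebase i) /\ mxact Q v = vscale (enorm v) (ebase j).
Proof.
move=> ij x0 xv.
pose H1 := householder (vsub x (vscale (enorm x) (ebase i))).
have H1o : H1 *m H1^T = 1%:M by exact: householder_orthogonal.
have H1x : mxact H1 x = vscale (enorm x) (ebase i).
  apply: householder_swap; rewrite inner_vscalel inner_vscaler inner_ebase eqxx.
  by rewrite mulr1 -expr2 enorm_sqr.
pose v1 := mxact H1 v.
have v1i : inner (ebase i) v1 = 0.
  have := inner_mxact x v H1o; rewrite H1x xv inner_vscalel => /eqP.
  rewrite mulf_eq0 => /orP[/eqP e0|/eqP//].
  by move: x0; rewrite -enorm_sqr e0 expr0n eqxx.
pose H2 := householder (vsub v1 (vscale (enorm v) (ebase j))).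
have H2o : H2 *m H2^T = 1%:M by exact: householder_orthogonal.
have H2i : mxact H2 (ebase i) = ebase i.
  apply: householder_id; rewrite !inner_simp innerC v1i inner_ebase eq_sym.
  by rewrite (negbTE ij) mulr0 subr0.
have H2v : mxact H2 v1 = vscale (enorm v) (ebase j).
  apply: householder_swap; rewrite !inner_simp inner_ebase eqxx mulr1 -expr2.
  by rewrite enorm_sqr inner_mxact.
exists (H2 *m H1).
  by rewrite trmx_mul mulmxA -(mulmxA H2) H1o mulmx1.
by rewrite !mxactM H1x mxact_vscale H2i.
Qed.

Lemma rotation_to_ebase x i : inner x x = 1 ->
  exists2 Q : 'M[R]_n, Q *m Q^T = 1%:M & mxact Q x = ebase i.
Proof.
move=> x1; exists (householder (vsub x (ebase i))).
  exact: householder_orthogonal.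
by apply: householder_swap; rewrite x1 inner_ebase eqxx.
Qed.

Lemma unit_sphere_inner x : unit_sphere x <-> inner x x = 1.
Proof.
rewrite /unit_sphere/=; split=> [x1|x1]; first by rewrite -enorm_sqr x1 expr1n.
by rewrite /enorm x1 sqrtr1.
Qed.

Lemma unit_sphere_mxact Q x : Q *m Q^T = 1%:M ->
  unit_sphere (mxact Q x) <-> unit_sphere x.
Proof. by move=> Qo; rewrite !unit_sphere_inner inner_mxact. Qed.

Lemma unit_sphere_le1 x i : unit_sphere x -> tnth x i ^+ 2 <= 1.
Proof.
move/unit_sphere_inner <-; rewrite /inner (bigD1 i)//= -expr2 lerDl.
by apply: sumr_ge0 => j _; rewrite -expr2 sqr_ge0.
Qed.

End euclidean_space.

Section euclidean_measurability.
Context {R : realType} {n : nat} {d : measure_display} {T : measurableType d}.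
Implicit Types f g : T -> n.-tuple R.

Lemma measurable_inner f g : measurable_fun setT f -> measurable_fun setT g ->
  measurable_fun setT (fun w => inner (f w) (g w)).
Proof.
move=> mf mg; apply: measurable_sum => i; apply: measurable_funM.
- exact: (measurableT_comp (@measurable_tnth _ R n i)).
- exact: (measurableT_comp (@measurable_tnth _ R n i)).
Qed.

Lemma measurable_mxact Q f : measurable_fun setT f ->
  measurable_fun setT (fun w => mxact Q (f w) : n.-tuple R).
Proof.
move=> mf; apply/measurable_fun_tnthP => i.
rewrite (_ : _ \o _ = fun w => \sum_(j < n) Q i j * tnth (f w) j); last first.
  by apply/funext => w /=; rewrite tnth_mktuple.
apply: measurable_sum => j; apply: measurable_funM => //.
exact: (measurableT_comp (@measurable_tnth _ R n j)).
Qed.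

Lemma measurable_enorm f : measurable_fun setT f ->
  measurable_fun setT (fun w => enorm (f w)).
Proof.
move=> mf.
have ms : measurable_fun setT (Num.sqrt : R -> R).
  by apply: continuous_measurable_fun; exact: sqrt_continuous.
exact/(measurableT_comp ms)/measurable_inner.
Qed.

End euclidean_measurability.

Lemma measurable_unit_sphere {R : realType} n :
  measurable (unit_sphere : set (n.-tuple R)).
Proof.
rewrite -[X in measurable X]setTI.
have m : measurable_fun setT (fun x : n.-tuple R => enorm x).
  exact: measurable_enorm.
exact: (m measurableT [set 1] (measurable_set1 1)).
Qed.

(** * Product laws *)

(** Relative to a set [D], because the second moment of a codeword will be restricted to the event
    that this codeword is selected. *)
Lemma markov_sqr d (T : measurableType d) (R : realType)
    (mu : {measure set T -> \bar R}) (D : set T) (f : T -> R) (eps : R) :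
  measurable D -> measurable_fun D f -> 0 < eps ->
  (mu (D `&` [set x | (eps <= `|f x|)%R]) <=
    (eps ^+ 2)^-1%:E * \int[mu]_(x in D) (f x ^+ 2)%:E)%E.
Proof.
move=> mD mf e0.
have := @le_integral_comp_abse _ _ _ mu D mD (fun x => (f x ^+ 2)%:E) (eps ^+ 2) id.
move=> /(_ _ _ _ _ (exprn_gt0 _ e0)) H.
rewrite -lee_pdivrMl ?invr_gt0 ?exprn_gt0// invrK.
have -> : [set x | eps <= `|f x|] = [set x | ((eps ^+ 2)%:E <= `|(f x ^+ 2)%:E|)%E].
  apply/seteqP; split => x /=; rewrite lee_fin normrX ler_pXn2r// nnegrE ltW//.
apply: le_trans (H _ _ _ _) _ => //.
- by apply/measurable_EFinP; exact: measurable_funX.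
- by under eq_integral => x _ do rewrite gee0_abs ?lee_fin ?sqr_ge0//.
Qed.

Lemma square_integrable_integrable d (T : measurableType d) (R : realType)
    (P : probability T R) (g : T -> R) (w : R) :
  measurable_fun setT g -> (\int[P]_x (g x ^+ 2)%:E <= w%:E)%E ->
  P.-integrable setT (EFin \o g).
Proof.
move=> mg gw.
apply: (@le_integrable _ _ _ _ _ _ _ (fun x => 1%:E + (g x ^+ 2)%:E)%E) => //.
- exact/measurable_EFinP.
- move=> x _ /=; rewrite lee_fin [leRHS]ger0_norm ?addr_ge0 ?sqr_ge0//.
  rewrite -(real_normK (num_real (g x))).
  have := sqr_ge0 (`|g x| - 1); have := sqr_ge0 (`|g x|); nra.
- apply: integrableD => //; first exact: finite_measure_integrable_cst.
  apply/integrableP; split; first by apply/measurable_EFinP; exact: measurable_funX.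
  under eq_integral do rewrite gee0_abs ?lee_fin ?sqr_ge0//.
  exact: le_lt_trans gw (ltry _).
Qed.

Section product_laws.
Context {d : measure_display} {T : measurableType d} {R : realType} {n : nat}.
Variable nu : 'I_n -> probability T R.

Definition box (A : 'I_n -> set T) : set (n.-tuple T) :=
  [set x | forall i, A i (tnth x i)].

Lemma measurable_box A : (forall i, measurable (A i)) -> measurable (box A).
Proof.
move=> mA; rewrite [box A](_ : _ = \bigcap_(i : 'I_n) (@tnth _ T ^~ i) @^-1` A i).
  apply: fin_bigcap_measurable => // i _.
  by rewrite -[X in measurable X]setTI; exact: measurable_tnth.
by apply/seteqP; split => x h i => [_|]; apply: h.
Qed.

Lemma measurable_tuple_boxE : @measurable _ (n.-tuple T) =
  <<s [set box A | A in [set A | forall i, measurable (A i)]] >>.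
Proof.
apply/seteqP; split.
- apply: smallest_sub; first exact: smallest_sigma_algebra.
  move=> B; rewrite -bigcup_seq/= => -[i _ [A mA <-]].
  apply: sub_sigma_algebra; exists (fun j => if j == i then A else setT).
    by move=> j; case: ifP.
  apply/seteqP; split => x; rewrite /box/= ?setTI => h.
    by have := h i; rewrite eqxx.
  by move=> j; case: eqP => [->|//]; case: h.
- apply: smallest_sub; first exact: sigma_algebra_measurable.
  by move=> _ [A mA <-]; exact: measurable_box.
Qed.

(** Boxes form a pi-system generating the sigma-algebra. Uniqueness is what passes rotation
    invariance from one codeword to the whole codebook. *)
Lemma product_law_unique (mu1 mu2 : probability (n.-tuple T) R) :
  product_law nu mu1 -> product_law nu mu2 ->
  forall A, measurable A -> mu1 A = mu2 A.
Proof.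
move=> h1 h2; apply: (measure_unique _ (fun=> setT) measurable_tuple_boxE).
- move=> _ _ [A mA <-] [B mB <-]; exists (fun i => A i `&` B i).
    by move=> i; exact: measurableI.
  by apply/seteqP; split => x; [move=> h; split => i; case: (h i)|case=> h k i; split].
- by move=> _; exists (fun=> setT) => //; apply/seteqP; split.
- by apply/seteqP; split => // x _; exists 0%N.
- by move=> _ [A mA <-]; rewrite [LHS](h1 _ mA) [RHS](h2 _ mA).
- by move=> _; rewrite /= probability_setT ltry.
Qed.

Variable mu : probability (n.-tuple T) R.
Hypothesis mu_nu : product_law nu mu.

Lemma product_law_marginal i (A : set T) : measurable A ->
  mu [set x | A (tnth x i)] = nu i A.
Proof.
move=> mA; pose B j := if j == i then A else setT.
rewrite (_ : [set x | _] = box B); last first.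
  apply/seteqP; split => x; rewrite /box/B/= => h; first by move=> j; case: eqP => // ->.
  by have := h i; rewrite eqxx.
rewrite [LHS](mu_nu (A:=B)) => [|j]; last by rewrite /B; case: ifP.
rewrite (bigD1 i)//= big1 ?mule1; first by rewrite /B eqxx.
by move=> j /negbTE ji; rewrite /B ji probability_setT.
Qed.

Lemma product_law_pair i j (A1 A2 : set T) : i != j -> measurable A1 -> measurable A2 ->
  mu [set x | A1 (tnth x i) /\ A2 (tnth x j)] = (nu i A1 * nu j A2)%E.
Proof.
move=> ij mA1 mA2.
pose B k := if k == i then A1 else if k == j then A2 else setT.
have Bi : B i = A1 by rewrite /B eqxx.
have Bj : B j = A2 by rewrite /B eq_sym (negbTE ij) eqxx.
rewrite (_ : [set x | _] = box B); last first.
  apply/seteqP; split => x; rewrite /box/= => h.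
    by move=> k; rewrite /B; case: eqP => [->|_]; [case: h|case: eqP => [->|//]; case: h].
  by split; [rewrite -Bi|rewrite -Bj]; exact: h.
rewrite [LHS](mu_nu (A:=B)) => [|k]; last by rewrite /B; case: ifP => // _; case: ifP.
rewrite (bigD1 i)//= (bigD1 j) ?(eq_sym j)//= big1 ?mule1; first by rewrite Bi Bj.
by move=> k /andP[/negbTE ki /negbTE kj]; rewrite /B ki kj probability_setT.
Qed.

Definition coord_pair i j (x : n.-tuple T) : T * T := (tnth x i, tnth x j).

Lemma measurable_coord_pair i j : measurable_fun setT (coord_pair i j).
Proof. by apply: measurable_fun_pair; exact: measurable_tnth. Qed.

(** Gives access to Fubini for two coordinates, both for the variance of a sum and for ties between
    two codewords. *)
Lemma product_law_coord_pair i j : i != j -> forall A, measurable A ->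
  pushforward mu (coord_pair i j) A = (nu i \x nu j)%E A.
Proof.
move=> ij A mA.
pose mix := isMeasurableFun.Build _ _ _ _ _ (measurable_coord_pair i j).
pose X : {mfun (n.-tuple T) >-> (T * T)%type} := MeasurableFun.Pack (MeasurableFun.Class mix).
pose m' := distribution mu X.
change (m' A = (nu i \x nu j)%E A); apply/esym.
apply: (@product_measure_unique _ _ _ _ _ (nu i) (nu j) m') => // A1 A2 mA1 mA2.
by rewrite -product_law_pair.
Qed.

Lemma product_law_uncorrelated i j (f g : T -> R) : i != j ->
  (nu i).-integrable setT (EFin \o f) -> (nu j).-integrable setT (EFin \o g) ->
  mu.-integrable setT (fun x => (f (tnth x i) * g (tnth x j))%:E) ->
  (\int[nu j]_x (g x)%:E = 0 ->
  \int[mu]_x (f (tnth x i) * g (tnth x j))%:E = 0)%E.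
Proof.
move=> ij fi gi fgi g0.
pose h (z : T * T) := (f z.1 * g z.2)%:E.
have mf : measurable_fun setT f by apply/measurable_EFinP; case/integrableP: fi.
have mg : measurable_fun setT g by apply/measurable_EFinP; case/integrableP: gi.
have mh : measurable_fun setT h.
  by apply/measurable_EFinP; apply: measurable_funM; exact: measurableT_comp.
have mc := measurable_coord_pair i j.
rewrite -[LHS](@integral_pushforward _ _ _ _ _ _ mc mu setT h mh)//.
rewrite (eq_measure_integral (nu i \x nu j)%E); last first.
  by move=> A mA _; exact: product_law_coord_pair.
have hi : (nu i \x nu j)%E.-integrable setT h.
  apply/integrable12ltyP => //.
  rewrite (eq_integral (fun x => (`|f x|)%:E * \int[nu j]_y (`|g y|)%:E)%E); last first.
    move=> x _; rewrite -ge0_integralZl_EFin//; last first.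
      by apply/measurable_EFinP; exact: measurableT_comp.
    by apply: eq_integral => y _; rewrite /h/= normrM EFinM.
  have /integrableP[_ fi1] := fi; have /integrableP[_ gi1] := gi.
  rewrite ge0_integralZr//; last 2 first.
  - by apply/measurable_EFinP; exact: measurableT_comp.
  - exact: integral_ge0.
  by rewrite lte_mul_pinfty// ?ge0_fin_numE ?integral_ge0.
rewrite -integral12_prod_meas1//= /fubini_F.
rewrite integral0_eq// => x _.
rewrite /h/=; under eq_integral do rewrite EFinM.
by rewrite integralZl// g0 mule0.
Qed.

Lemma product_law_integral i (f : T -> \bar R) : measurable_fun setT f ->
  (forall x, 0 <= f x)%E ->
  (\int[mu]_x f (tnth x i) = \int[nu i]_x f x)%E.
Proof.
move=> mf f0; have mt := @measurable_tnth _ T n i.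
rewrite -(@ge0_integral_pushforward _ _ _ _ _ _ mt mu setT f)//.
apply: eq_measure_integral => A mA _; exact: product_law_marginal.
Qed.

(** In the integral of the squared sum the off-diagonal terms vanish, so only the joint laws of
    pairs of coordinates enter. *)
Lemma product_law_chebyshev (f : 'I_n -> T -> R) (v : 'I_n -> R) (eps : R) :
  (forall i, measurable_fun setT (f i)) ->
  (forall i, \int[nu i]_x (f i x)%:E = 0)%E ->
  (forall i, \int[nu i]_x (f i x ^+ 2)%:E <= (v i)%:E)%E ->
  0 < eps ->
  (mu [set x | (eps <= `|\sum_(i < n) f i (tnth x i)|)%R] <=
    ((\sum_(i < n) v i) / eps ^+ 2)%:E)%E.
Proof.
move=> mf f0 fv e0.
pose F i (x : n.-tuple T) := f i (tnth x i).
have mF i : measurable_fun setT (F i).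
  by apply: measurableT_comp; [exact: mf|exact: measurable_tnth].
have FE i : (\int[mu]_x (F i x ^+ 2)%:E = \int[nu i]_x (f i x ^+ 2)%:E)%E.
  apply: (@product_law_integral i (fun x => (f i x ^+ 2)%:E)).
    by apply/measurable_EFinP; exact: measurable_funX.
  by move=> x; rewrite lee_fin sqr_ge0.
have fi i : (nu i).-integrable setT (EFin \o f i) by exact: square_integrable_integrable (fv i).
have Fi2 i : mu.-integrable setT (fun x => (F i x ^+ 2)%:E).
  apply/integrableP; split; first by apply/measurable_EFinP; exact: measurable_funX.
  under eq_integral do rewrite gee0_abs ?lee_fin ?sqr_ge0//.
  by rewrite FE (le_lt_trans (fv i))// ltry.
have FFi i j : mu.-integrable setT (fun x => (F i x * F j x)%:E).
  apply: (@le_integrable _ _ _ _ _ _ _ (fun x => (F i x ^+ 2)%:E + (F j x ^+ 2)%:E)%E) => //.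
  - by apply/measurable_EFinP; exact: measurable_funM.
  - move=> x _ /=; rewrite lee_fin [leRHS]ger0_norm ?addr_ge0 ?sqr_ge0// normrM.
    rewrite -(real_normK (num_real (F i x))) -(real_normK (num_real (F j x))).
    have := sqr_ge0 (`|F i x| - `|F j x|); have := sqr_ge0 (`|F i x| + `|F j x|); nra.
  - by apply: integrableD => //; exact: Fi2.
have SE : (\int[mu]_x ((\sum_(i < n) F i x) ^+ 2)%:E <= (\sum_(i < n) v i)%:E)%E.
  under eq_integral do rewrite expr2 mulr_suml -sumEFin.
  rewrite integral_sum//=; last first.
    move=> i; under eq_fun do rewrite mulr_sumr -sumEFin.
    by apply: integrable_sum => // j _; exact: FFi.
  rewrite -sumEFin; apply: lee_sum => i _.
  under eq_integral do rewrite mulr_sumr -sumEFin.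
  rewrite integral_sum//= (bigD1 i)//= [X in (_ + X)%E]big1 ?adde0.
    by under eq_integral do rewrite -expr2; rewrite FE.
  by move=> j ji; apply: product_law_uncorrelated (FFi i j) (f0 j); rewrite 1?eq_sym.
pose S x := \sum_(i < n) F i x.
have mS : measurable_fun setT S by exact: measurable_sum.
rewrite -[X in mu X]setTI; apply: le_trans (markov_sqr _ _ mS e0) _ => //.
by rewrite mulrC EFinM lee_pmul2l// lte_fin invr_gt0 exprn_gt0.
Qed.

End product_laws.

(** * Moments of the normal law *)

Lemma integral_probability_cst d (T : measurableType d) (R : realType)
    (P : probability T R) (c : R) : (\int[P]_x c%:E = c%:E)%E.
Proof. by have := integral_cst P measurableT c%:E; rewrite /= probability_setT mule1. Qed.

Section density.
Context d (T : measurableType d) (R : realType).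
Variables (nu mu : {measure set T -> \bar R}) (g : T -> R).
Hypotheses (mg : measurable_fun setT g) (g0 : forall x, 0 <= g x).
Hypothesis nuE : forall A, measurable A -> nu A = (\int[mu]_(x in A) (g x)%:E)%E.

Import HBNNSimple.

Let integral_density_nnsfun (h : {nnsfun T >-> R}) :
  (\int[nu]_x (h x)%:E = \int[mu]_x ((h x)%:E * (g x)%:E))%E.
Proof.
under [LHS]eq_integral do rewrite fimfunE -fsumEFin//.
rewrite [LHS]ge0_integral_fsum//; last 2 first.
  - by move=> r; exact/measurable_EFinP/measurableT_comp.
  - by move=> r x _; rewrite EFinM nnfun_muleindic_ge0.
under [RHS]eq_integral.
  move=> x xD; rewrite fimfunE -fsumEFin// ge0_mule_fsuml; last first.
    by move=> r; rewrite EFinM nnfun_muleindic_ge0.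
  over.
rewrite [RHS]ge0_integral_fsum//; last 2 first.
  - move=> r; apply/measurable_EFinP/measurable_funM => //.
    exact/measurableT_comp.
  - move=> r x _; rewrite EFinM mule_ge0 ?lee_fin//.
    by have := nnfun_muleindic_ge0 h r x; rewrite -EFinM lee_fin.
apply: eq_fsbigr => r _.
rewrite integralZl_indic_nnsfun//= integral_indic// setIT nuE//.
have [r0|r0] := ltP r 0.
  rewrite preimage_nnfun0// integral_set0 mule0; apply/esym/integral0_eq => x _.
  by rewrite indic0 mulr0 mul0e.
rewrite integral_mkcond -ge0_integralZl_EFin//; last 2 first.
  - by move=> x _; rewrite patchE; case: ifP => // _; rewrite lee_fin.
  - apply/(measurable_restrictT _ _).1 => //.
    by apply/measurable_funTS/measurable_EFinP.
apply: eq_integral => x _; rewrite patchE -EFinM indicE.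
by case: ifP => _; rewrite ?mulr1 ?mulr0 ?mul0r ?mule0.
Qed.

(** Simple functions are settled above; monotone convergence on both sides does the rest. *)
Lemma ge0_integral_density (f : T -> \bar R) :
  measurable_fun setT f -> (forall x, 0 <= f x)%E ->
  (\int[nu]_x f x = \int[mu]_x (f x * (g x)%:E))%E.
Proof.
move=> mf f0; pose f_ := nnsfun_approx measurableT mf.
have fcvg x : (f_ n x)%:E @[n --> \oo] --> f x by exact: cvg_nnsfun_approx.
transitivity (limn (fun n => \int[nu]_x (f_ n x)%:E))%E.
  rewrite -monotone_convergence//=.
  - by apply: eq_integral => x _; apply/esym/cvg_lim => //; exact: fcvg.
  - by move=> n; exact/measurable_EFinP.
  - by move=> n x _; rewrite lee_fin.
  - by move=> x _ ? ? mn; rewrite lee_fin; exact/lefP/nd_nnsfun_approx.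
transitivity (limn (fun n => \int[mu]_x ((f_ n x)%:E * (g x)%:E)))%E.
  by apply/congr_lim/funext => n; exact: integral_density_nnsfun.
rewrite -monotone_convergence//=.
- apply: eq_integral => x _; apply/cvg_lim => //.
  by apply: cvgeZr => //; exact: fcvg.
- by move=> n; apply/measurable_EFinP/measurable_funM.
- by move=> n x _; rewrite -EFinM lee_fin mulr_ge0.
- move=> x _ ? ? mn; rewrite -!EFinM lee_fin ler_wpM2r//.
  exact/lefP/nd_nnsfun_approx.
Qed.

End density.

Lemma normal_peakE (R : realType) (t : R) : 0 < t ->
  normal_peak t = (t * Num.sqrt (pi *+ 2))^-1.
Proof.
move=> t0; rewrite /normal_peak -mulrnAr sqrtrM ?sqr_ge0//.
by rewrite sqrtr_sqr gtr0_norm.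
Qed.

Section normal_moments.
Context {R : realType} (m s : R).
Hypothesis s0 : 0 < s.
Local Notation N := (normal_prob m s).

(* Integrating the likelihood ratio of N(m', s'^2) with respect to N(m, s^2). *)
Lemma normal_likelihood_ratio (m' s' : R) : 0 < s' ->
  (\int[N]_x (expR ((x - m) ^+ 2 / (s ^+ 2 *+ 2) - (x - m') ^+ 2 / (s' ^+ 2 *+ 2)))%:E
   = (s' / s)%:E)%E.
Proof.
move=> s'0.
rewrite (@ge0_integral_density _ _ R N lebesgue_measure (normal_pdf m s))//; last 3 first.
- exact: measurable_normal_pdf.
- exact: normal_pdf_ge0.
- apply/measurable_EFinP; apply: measurableT_comp => //.
  by apply: measurable_funB; apply: measurable_funM => //;
    apply: measurable_funX; exact: measurable_funB.
under eq_integral => x _.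
  have -> : ((expR ((x - m) ^+ 2 / (s ^+ 2 *+ 2) - (x - m') ^+ 2 / (s' ^+ 2 *+ 2)))%:E
    * (normal_pdf m s x)%:E = (s' / s)%:E * (normal_pdf m' s' x)%:E)%E.
    rewrite -!EFinM !normal_pdfE ?gt_eqF// /normal_fun mulrCA -expRD.
    rewrite (_ : _ + _ = - (x - m') ^+ 2 / (s' ^+ 2 *+ 2)); last by ring.
    rewrite mulrA; congr (_ * _)%:E; rewrite !normal_peakE//.
    have : Num.sqrt (pi *+ 2 : R) != 0.
      by rewrite gt_eqF// sqrtr_gt0 mulrn_wgt0// pi_gt0.
    by move=> Q0; field; rewrite Q0 !gt_eqF.
  over.
rewrite ge0_integralZl_EFin//.
- by rewrite integral_normal_pdf mule1.
- by move=> x _; rewrite lee_fin normal_pdf_ge0.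
- by apply/measurable_EFinP; exact: measurable_normal_pdf.
- by rewrite divr_ge0// ltW.
Qed.

Let meas_centered k : measurable_fun setT (fun x : R => (x - m) ^+ k).
Proof. by apply: measurable_funX; exact: measurable_funB. Qed.

Let Ncst c : (\int[N]_x c%:E = c%:E)%E.
Proof. exact: (integral_probability_cst N c). Qed.

Local Notation v := (\int[N]_x ((x - m) ^+ 2)%:E)%E.

(* Both bounds integrate the tangent line inequality expR u >= 1 + u for the
   likelihood ratio of N(m, (y s)^2). *)
Let v_le y : 1 < y -> (v <= (s ^+ 2 *+ 2 * y ^+ 2 / (y + 1))%:E)%E.
Proof.
move=> y1; have y0 : 0 < y by lra.
have s2 : 0 < s ^+ 2 *+ 2 by rewrite mulrn_wgt0// exprn_gt0.
(* The log-likelihood ratio is [h * (x - m) ^+ 2], so 1 + h v <= y, and (y - 1) / h is the claimed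
   bound. *)
pose h := (1 - y ^- 2) / (s ^+ 2 *+ 2).
have h0 : 0 < h.
  rewrite divr_gt0// subr_gt0 invf_lt1 ?exprn_gt0//.
  by rewrite exprn_egt1.
have : (\int[N]_x (1%:E + h%:E * ((x - m) ^+ 2)%:E) <= y%:E)%E.
  have <- : y * s / s = y by rewrite mulfK// gt_eqF.
  rewrite -(normal_likelihood_ratio m (mulr_gt0 y0 s0)); apply: ge0_le_integral => //.
  - by move=> x _; rewrite -EFinM -EFinD lee_fin addr_ge0// mulr_ge0 ?sqr_ge0// ltW.
  - apply/measurable_EFinP; apply: measurable_funD => //.
    by apply: measurable_funM => //; exact: meas_centered.
  - apply/measurable_EFinP; apply: measurableT_comp => //.
    by apply: measurable_funB; apply: measurable_funM => //; exact: meas_centered.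
  - move=> x _; rewrite -EFinM -EFinD lee_fin; apply: le_trans (expR_ge1Dx _).
    rewrite lerD2l le_eqVlt; apply/orP; left; apply/eqP; rewrite /h; field.
    by rewrite !gt_eqF.
rewrite ge0_integralD//; last 2 first.
- by move=> x _; rewrite -EFinM lee_fin mulr_ge0 ?sqr_ge0// ltW.
- apply/measurable_EFinP/measurable_funM => //; exact: meas_centered.
rewrite ge0_integralZl_EFin//; last 3 first.
- by move=> x _; rewrite lee_fin sqr_ge0.
- by apply/measurable_EFinP; exact: meas_centered.
- exact: ltW.
rewrite Ncst -lee_suber_addl// -EFinB -lee_pdivlMl//.
rewrite -EFinM => /le_trans; apply; rewrite lee_fin /h le_eqVlt; apply/orP; left.
apply/eqP; field; rewrite !gt_eqF//; nra.
Qed.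

Let v_ge y : 0 < y < 1 -> ((s ^+ 2 *+ 2 * y ^+ 2 / (y + 1))%:E <= v)%E.
Proof.
move=> /andP[y0 y1].
have s2 : 0 < s ^+ 2 *+ 2 by rewrite mulrn_wgt0// exprn_gt0.
(* The sign is flipped: for [y < 1] the exponent is - h (x - m)^2 with [h] positive, and the tangent
   line now bounds [v] from below. *)
pose h := (y ^- 2 - 1) / (s ^+ 2 *+ 2).
have h0 : 0 < h.
  by rewrite divr_gt0// subr_gt0 invf_gt1 ?exprn_gt0// exprn_ilt1// ltW.
have : (1%:E <= y%:E + h%:E * v)%E.
  have yE : y * s / s = y by rewrite mulfK// gt_eqF.
  rewrite -[in leRHS]yE -(normal_likelihood_ratio m (mulr_gt0 y0 s0)).
  have mh : measurable_fun setT (fun x : R => (h%:E * ((x - m) ^+ 2)%:E)%E).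
    by apply/measurable_EFinP; apply: measurable_funM => //; exact: meas_centered.
  have ml : measurable_fun setT (fun x : R => (expR ((x - m) ^+ 2 / (s ^+ 2 *+ 2) -
      (x - m) ^+ 2 / ((y * s) ^+ 2 *+ 2)))%:E).
    apply/measurable_EFinP; apply: measurableT_comp => //.
    by apply: measurable_funB; apply: measurable_funM => //; exact: meas_centered.
  rewrite -ge0_integralZl_EFin//; last 3 first.
  - by move=> x _; rewrite lee_fin sqr_ge0.
  - by apply/measurable_EFinP; exact: meas_centered.
  - exact: ltW.
  rewrite -ge0_integralD//; last first.
    by move=> x _; rewrite -EFinM lee_fin mulr_ge0 ?sqr_ge0// ltW.
  rewrite -[leLHS]Ncst.
  apply: ge0_le_integral => //.
  - exact: emeasurable_funD.
  - move=> x _; rewrite -EFinM -EFinD lee_fin -lerBlDr.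
    apply: le_trans (expR_ge1Dx _).
    rewrite lerD2l le_eqVlt; apply/orP; left; apply/eqP; rewrite /h; field.
    by rewrite !gt_eqF.
rewrite -leeBlDl// -EFinB => le1.
rewrite -(lee_pmul2l (_ : h%:E \is a fin_num))// ?lte_fin//.
apply: le_trans le1; rewrite -EFinM lee_fin /h le_eqVlt; apply/orP; left.
apply/eqP; field; rewrite !gt_eqF//; nra.
Qed.

(** Both bounds tend to s^2 as y tends to 1, one from each side. *)
Lemma normal_second_moment : (v = (s ^+ 2)%:E)%E.
Proof.
have s2 : 0 < s ^+ 2 by rewrite exprn_gt0.
have : (0 <= v)%E by apply: integral_ge0 => x _; rewrite lee_fin sqr_ge0.
(* An infinite second moment is excluded by the upper bound at y = 2. *)
case: v v_le v_ge => [w| |] // le1 ge1 w0; last first.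
  by have := le1 2 ltac:(lra).
congr EFin; apply/eqP; rewrite eq_le; apply/andP; split.
- apply/ler_addgt0Pr => e e0.
  pose y := 1 + Num.min 1 (e / (s ^+ 2 * 4)).
  have e4 : 0 < e / (s ^+ 2 * 4) by rewrite divr_gt0// mulr_gt0.
  have y1 : 1 < y by rewrite ltrDl lt_min ltr01 e4.
  have := le1 y y1; rewrite lee_fin => /le_trans; apply.
  rewrite ler_pdivrMr; last lra.
  have : y - 1 <= 1 by rewrite /y addrAC subrr add0r ge_min lexx.
  have : y - 1 <= e / (s ^+ 2 * 4) by rewrite /y addrAC subrr add0r ge_min lexx orbT.
  rewrite ler_pdivlMr ?mulr_gt0// mulr2n; set S := s ^+ 2 in s2 *.
  have -> : y = 1 + (y - 1) by ring.
  have : 0 < y - 1 by lra.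
  move: (y - 1) => d d0 h1 h2.
  have Sd : 0 < S * d by rewrite mulr_gt0.
  have Sd2 : S * d * d <= S * d * 1 by rewrite ler_pM2l//; lra.
  have ed : 0 < e * d by rewrite mulr_gt0.
  nra.
- apply/ler_addgt0Pr => e e0.
  pose y := 1 - Num.min (1/2) (e / (s ^+ 2 * 4)).
  have e4 : 0 < e / (s ^+ 2 * 4) by rewrite divr_gt0// mulr_gt0.
  have yh : 1 / 2 <= y.
    by have : 1 - y <= 1/2; [rewrite /y opprB addrCA subrr addr0 ge_min lexx|lra].
  have y1 : y < 1 by rewrite gtrBl lt_min e4 andbT; lra.
  rewrite -lerBlDr.
  have : ((s ^+ 2 *+ 2 * y ^+ 2 / (y + 1))%:E <= w%:E)%E by apply: ge1; lra.
  rewrite lee_fin; apply: le_trans.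
  rewrite ler_pdivlMr; last lra.
  have : 1 - y <= e / (s ^+ 2 * 4).
    by rewrite /y opprB addrCA subrr addr0 ge_min lexx orbT.
  rewrite ler_pdivlMr ?mulr_gt0// mulr2n; set S := s ^+ 2 in s2 *.
  have -> : y = 1 - (1 - y) by ring.
  have : 0 < 1 - y by lra.
  have : 1 - y <= 1 / 2 by lra.
  move: (1 - y) => d dh d0 h1.
  have Sd : 0 < S * d by rewrite mulr_gt0.
  have Sd2 : 0 <= S * d * d by rewrite mulr_ge0// ltW.
  have ed : 0 < e * d by rewrite mulr_gt0.
  have ed1 : e * d <= e * (1 / 2) by rewrite ler_pM2l//.
  nra.
Qed.

(** The likelihood ratio of N(m, (2 s)^2) is expR u with u = 3 (x - m)^2 / (8 s^2). Since u^2 / 2 <=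
    expR u, it dominates (x - m)^4 up to the factor 32 s^4, and its integral is 2. Only the order
    s^4 matters later. *)
Lemma normal_fourth_moment :
  (\int[N]_x ((x - m) ^+ 4)%:E <= (64 * s ^+ 4)%:E)%E.
Proof.
have s2 : 0 < s ^+ 2 *+ 2 by rewrite mulrn_wgt0// exprn_gt0.
have l := @normal_likelihood_ratio m (2 * s) (mulr_gt0 (ltr0n _ 2) s0).
have ml : measurable_fun setT (fun x : R => (expR ((x - m) ^+ 2 / (s ^+ 2 *+ 2) -
      (x - m) ^+ 2 / ((2 * s) ^+ 2 *+ 2)))%:E).
  apply/measurable_EFinP; apply: measurableT_comp => //.
  by apply: measurable_funB; apply: measurable_funM => //; exact: meas_centered.
apply: (@le_trans _ _ (\int[N]_x ((32 * s ^+ 4)%:E * (expR ((x - m) ^+ 2 / (s ^+ 2 *+ 2) -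
      (x - m) ^+ 2 / ((2 * s) ^+ 2 *+ 2)))%:E))%E).
  apply: ge0_le_integral => //.
  - by move=> x _; rewrite lee_fin exprn_even_ge0.
  - by apply/measurable_EFinP; exact: meas_centered.
  - by apply: emeasurable_funM.
  - move=> x _; rewrite -EFinM lee_fin.
    set u := (X in expR X).
    have uE : u = (x - m) ^+ 2 * 3 / (8 * s ^+ 2) by rewrite /u; field; rewrite gt_eqF.
    have u0 : 0 <= u by rewrite uE; apply: divr_ge0; apply: mulr_ge0; rewrite ?sqr_ge0.
    have := expR_ge1Dxn 1 u0; rewrite (_ : 2`! = 2)%N// => h.
    have : u ^+ 2 / 2 <= expR u by lra.
    have -> : (x - m) ^+ 4 = u ^+ 2 * 64 / 9 * s ^+ 4.
      by rewrite uE; field; rewrite gt_eqF.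
    have s4 : 0 <= s ^+ 4 by rewrite exprn_ge0// ltW.
    have u2 : 0 <= u ^+ 2 by rewrite sqr_ge0.
    move=> h2; rewrite [leRHS]mulrAC ler_wpM2r//; lra.
rewrite ge0_integralZl_EFin//; last by rewrite mulr_ge0// exprn_ge0// ltW.
by rewrite l -EFinM lee_fin mulfK ?gt_eqF//; nra.
Qed.

Lemma normal_centered_integrable : N.-integrable setT (fun x => (x - m)%:E).
Proof.
apply: (@square_integrable_integrable _ _ R N (fun x => x - m) (s ^+ 2)).
  exact: measurable_funB.
by rewrite normal_second_moment.
Qed.

(** The tangent line inequality for the likelihood ratio of N(m + t, s^2) gives t E <= t^2 / 2 for
    every t, E being the integral; t = E forces E = 0. *)
Lemma normal_first_moment : (\int[N]_x (x - m)%:E = 0)%E.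
Proof.
have s2 : 0 < s ^+ 2 by rewrite exprn_gt0.
have int := normal_centered_integrable.
set E := (\int[N]_x _)%E.
have Efin : E \is a fin_num by exact: integrable_fin_num.
have key t : (1 + ((t / s ^+ 2)%:E * E - (t ^+ 2 / (s ^+ 2 *+ 2))%:E) <= 1)%E.
  have l := normal_likelihood_ratio (m + t) s0.
  rewrite divff ?gt_eqF// in l; rewrite -[leRHS]l.
  rewrite -[X in (X + _)%E]Ncst -(Ncst (t ^+ 2 / (s ^+ 2 *+ 2))).
  have Ncst_int c : N.-integrable setT (fun=> c%:E).
    exact: (finite_measure_integrable_cst N).
  have Zint : N.-integrable setT (fun x => (t / s ^+ 2)%:E * (x - m)%:E)%E.
    exact: integrableZl.
  rewrite -integralZl// -integralB// -integralD//; last exact: integrableB.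
  apply: le_integral => //.
  - by apply: integrableD => //; exact: integrableB.
  - apply/integrableP; split.
      apply/measurable_EFinP; apply: measurableT_comp => //.
      apply: measurable_funB; apply: measurable_funM => //; first exact: meas_centered.
      by apply: measurable_funX; exact: measurable_funB.
    under eq_integral do rewrite gee0_abs ?lee_fin ?expR_ge0//.
    by rewrite l ltry.
  - move=> x _; rewrite -EFinM -EFinB -EFinD lee_fin; apply: le_trans (expR_ge1Dx _).
    rewrite lerD2l le_eqVlt; apply/orP; left; apply/eqP; field.
    by rewrite gt_eqF.
case: (E) Efin key => // w _ key.
have {}key t : t / s ^+ 2 * w <= t ^+ 2 / (s ^+ 2 *+ 2).
  by have := key t; rewrite -EFinM -EFinB -EFinD lee_fin; lra.
congr EFin; have := key w; set q := _ / (_ *+ 2).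
have -> : w / s ^+ 2 * w = 2 * q by rewrite /q; field; rewrite gt_eqF.
have q0 : 0 <= q by rewrite divr_ge0 ?sqr_ge0// mulrn_wge0// ltW.
have : w ^+ 2 = q * (s ^+ 2 *+ 2) by rewrite /q divfK// gt_eqF// mulrn_wgt0.
move=> wq h; apply/eqP; rewrite -sqrf_eq0 wq (_ : q = 0) ?mul0r//; lra.
Qed.

End normal_moments.

(* The library's normal_prob lives on measurableTypeR R, whose display differs
   from that of R, hence the transfer along the identity. *)
Section normal_law.
Context {R : realType}.

Let idR (x : measurableTypeR R) : R := x.

Let measurable_idR : measurable_fun setT idR.
Proof. by move=> _ A mA; rewrite setTI. Qed.

HB.instance Definition _ := isMeasurableFun.Build _ _ _ _ _ measurable_idR.

Definition normal_law (m s : R) : probability R R :=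
  distribution (normal_prob m s) idR.

Lemma ge0_integral_normal_law (m s : R) (f : R -> \bar R) :
  measurable_fun setT f -> (forall x, 0 <= f x)%E ->
  (\int[normal_law m s]_x f x = \int[normal_prob m s]_x f x)%E.
Proof. by move=> mf f0; rewrite /normal_law ge0_integral_distribution. Qed.

Lemma normal_law_second_moment (m s : R) : 0 < s ->
  (\int[normal_law m s]_x ((x - m) ^+ 2)%:E = (s ^+ 2)%:E)%E.
Proof.
move=> s0; rewrite ge0_integral_normal_law ?normal_second_moment//.
- by apply/measurable_EFinP; apply: measurable_funX; exact: measurable_funB.
- by move=> x; rewrite lee_fin sqr_ge0.
Qed.

Lemma normal_law_fourth_moment (m s : R) : 0 < s ->
  (\int[normal_law m s]_x ((x - m) ^+ 4)%:E <= (64 * s ^+ 4)%:E)%E.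
Proof.
move=> s0; rewrite ge0_integral_normal_law ?normal_fourth_moment//.
- by apply/measurable_EFinP; apply: measurable_funX; exact: measurable_funB.
- by move=> x; rewrite lee_fin exprn_even_ge0.
Qed.

Lemma normal_law_centered_integrable (m s : R) : 0 < s ->
  (normal_law m s).-integrable setT (fun x => (x - m)%:E).
Proof.
move=> s0; apply: (@square_integrable_integrable _ _ R (normal_law m s) (fun x => x - m) (s ^+ 2)).
  exact: measurable_funB.
by rewrite normal_law_second_moment.
Qed.

Lemma normal_law_first_moment (m s : R) : 0 < s ->
  (\int[normal_law m s]_x (x - m)%:E = 0)%E.
Proof.
move=> s0; rewrite -[RHS](normal_first_moment m s0) /normal_law integral_distribution//.
- by apply/measurable_EFinP; exact: measurable_funB.
- exact: normal_centered_integrable.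
Qed.

End normal_law.

(** * Concentration of the Gaussian noise: its norm and its component along theta *)

Section gaussian_concentration.
Context {R : realType} {n : nat} (theta : n.-tuple R) (sigma : R).
Hypothesis sigma0 : 0 < sigma.
Variable mu : probability (n.-tuple R) R.
Hypothesis gauss : gaussian_law theta sigma mu.

Let nu i := normal_law (tnth theta i) sigma.

Lemma gaussian_inner_chebyshev (eps : R) : 0 < eps ->
  (mu [set x | (eps <= `|inner theta (vsub x theta)|)%R] <=
    (sigma ^+ 2 * enorm theta ^+ 2 / eps ^+ 2)%:E)%E.
Proof.
move=> e0; pose f i (x : R) := tnth theta i * (x - tnth theta i).
pose v i := sigma ^+ 2 * tnth theta i ^+ 2.
rewrite (_ : [set x | _] = [set x | eps <= `|\sum_(i < n) f i (tnth x i)|]); last first.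
  have E x : inner theta (vsub x theta) = \sum_(i < n) f i (tnth x i).
    by apply: eq_bigr => i _; rewrite tnth_mktuple.
  by apply/seteqP; split => x /=; rewrite E.
rewrite enorm_sqr /inner mulr_sumr.
under [X in (_ <= (X / _)%:E)%E]eq_bigr do rewrite -expr2.
have mc i : measurable_fun setT (fun x : R => x - tnth theta i).
  exact: measurable_funB.
apply: (@product_law_chebyshev _ _ _ _ nu mu gauss f v) => //.
- by move=> i; apply: measurable_funM.
- move=> i; rewrite /f; under eq_integral do rewrite EFinM.
  rewrite integralZl//; last exact: normal_law_centered_integrable.
  by rewrite normal_law_first_moment// mule0.
- move=> i; rewrite /f; under eq_integral do rewrite exprMn EFinM.
  rewrite ge0_integralZl_EFin ?sqr_ge0//.
  + by rewrite normal_law_second_moment// -EFinM /v mulrC.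
  + by move=> x _; rewrite lee_fin sqr_ge0.
  + by apply/measurable_EFinP; exact: measurable_funX.
Qed.

Lemma gaussian_norm_chebyshev (eps : R) : 0 < eps ->
  (mu [set x | (eps <= `|inner (vsub x theta) (vsub x theta) - n%:R * sigma ^+ 2|)%R] <=
    (n%:R * (65 * sigma ^+ 4) / eps ^+ 2)%:E)%E.
Proof.
move=> e0; pose f i (x : R) := (x - tnth theta i) ^+ 2 - sigma ^+ 2.
have E x : inner (vsub x theta) (vsub x theta) - n%:R * sigma ^+ 2 =
    \sum_(i < n) f i (tnth x i).
  rewrite sumrB sumr_const card_ord mulr_natl; congr (_ - _).
  by apply: eq_bigr => i _; rewrite tnth_mktuple.
under eq_set do rewrite E.
have -> : n%:R * (65 * sigma ^+ 4) = \sum_(i < n) 65 * sigma ^+ 4.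
  by rewrite sumr_const card_ord (mulr_natl _ n).
have s2 : 0 <= sigma ^+ 2 by rewrite sqr_ge0.
have mc i k : measurable_fun setT (fun x : R => (x - tnth theta i) ^+ k).
  by apply: measurable_funX; exact: measurable_funB.
have mf i : measurable_fun setT (f i) by apply: measurable_funB.
(* 65 = 64 + 1: the fourth moment bound plus sigma^4, the cross term of the square being dropped. *)
have f2 i : (\int[nu i]_x (f i x ^+ 2)%:E <= (65 * sigma ^+ 4)%:E)%E.
  apply: (@le_trans _ _ (\int[nu i]_x (((x - tnth theta i) ^+ 4)%:E + (sigma ^+ 4)%:E))%E).
    apply: ge0_le_integral => //.
    - by move=> x _; rewrite lee_fin sqr_ge0.
    - by apply/measurable_EFinP; apply: measurable_funX.
    - by apply/measurable_EFinP; apply: measurable_funD.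
    - move=> x _; rewrite -EFinD lee_fin /f.
      rewrite (exprM _ 2 2) (exprM sigma 2 2) sqrrB lerD2r gerBl mulrn_wge0//.
      by rewrite mulr_ge0// sqr_ge0.
  rewrite ge0_integralD//.
  - have := normal_law_fourth_moment (tnth theta i) sigma0.
    rewrite -/(nu i) (integral_probability_cst (nu i)) => h.
    apply: le_trans (leeD h (lexx _)) _; rewrite -EFinD lee_fin; lra.
  - by move=> x _; rewrite lee_fin exprn_even_ge0.
  - by apply/measurable_EFinP.
  - by move=> x _; rewrite lee_fin exprn_even_ge0.
apply: (@product_law_chebyshev _ _ _ _ nu mu gauss f (fun=> 65 * sigma ^+ 4)) => //.
move=> i; rewrite /f; under eq_integral do rewrite EFinB.
have ci : (nu i).-integrable setT (fun=> (sigma ^+ 2)%:E).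
  exact: finite_measure_integrable_cst.
rewrite integralB//; last first.
  apply: (@square_integrable_integrable _ _ R (nu i) (fun x => (x - tnth theta i) ^+ 2) (64 * sigma ^+ 4)).
    exact: mc.
  under eq_integral do rewrite -exprM.
  exact: normal_law_fourth_moment.
rewrite (integral_probability_cst (nu i)) normal_law_second_moment//.
by rewrite subee.
Qed.

End gaussian_concentration.

(** * The uniform law on the sphere *)

Lemma horner_ext_eq0 (R : realType) (p : {poly R}) : (forall x, p.[x] = 0) -> p = 0.
Proof.
move=> p0; apply/eqP/negPn/negP => /max_poly_roots.
move=> /(_ [seq i%:R | i <- iota 0 (size p)]); rewrite size_map size_iota ltnn.
move=> H; suff : false by []; apply: H.
- by apply/allP => _ /mapP[i _ ->]; rewrite /root p0.
- by rewrite map_inj_uniq ?iota_uniq// => i j /eqP; rewrite eqr_nat => /eqP.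
Qed.

Lemma Rintegral_sum d (T : measurableType d) (R : realType)
    (mu : {measure set T -> \bar R}) (D : set T) (I : Type) (s : seq I) (F : I -> T -> R) :
  measurable D -> (forall i, mu.-integrable D (EFin \o F i)) ->
  \int[mu]_(x in D) (\sum_(i <- s) F i x) = \sum_(i <- s) \int[mu]_(x in D) F i x.
Proof.
move=> mD intF; rewrite /Rintegral.
under eq_integral do rewrite -sumEFin.
rewrite integral_sum//.
rewrite sum_fine// => i _. exact: (integrable_fin_num mD (intF i)).
Qed.

Section uniform_sphere.
Context {R : realType} {n : nat} (nu : probability (n.-tuple R) R).
Hypothesis nu_unif : uniform_sphere_law nu.
Local Notation D := (unit_sphere : set (n.-tuple R)).
Local Notation "'EE' f" := (\int[nu]_(x in D) f x) (at level 10).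
Implicit Types (f g : n.-tuple R -> R) (i j : 'I_n) (k : nat).

Let mD : measurable D. Proof. exact: measurable_unit_sphere. Qed.

Let nuD : nu D = 1%E. Proof. by case: nu_unif. Qed.

(** Monomials are bounded on the sphere only, hence integrals over [D], which carries the full
    mass. *)
Lemma sphere_integrable f (M : R) : measurable_fun setT f ->
  (forall x, D x -> `|f x| <= M) -> nu.-integrable D (EFin \o f).
Proof.
move=> mf fM; apply: measurable_bounded_integrable => //.
- exact: le_lt_trans (probability_le1 nu mD) (ltry _).
- exact: measurable_funTS.
- exists M; split => [|m Mm x Dx]; first exact: num_real.
  exact: le_trans (fM x Dx) (ltW Mm).
Qed.

Lemma sphere_rotation f (M : R) (Q : 'M[R]_n) : Q *m Q^T = 1%:M ->
  measurable_fun setT f -> (forall x, D x -> `|f x| <= M) ->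
  EE (fun x => f (mxact Q x)) = EE f.
Proof.
move=> Qo mf fM; congr fine.
have mQ : measurable_fun setT (fun x : n.-tuple R => mxact Q x) by exact: measurable_mxact.
have QD : (fun x : n.-tuple R => mxact Q x) @^-1` D = D.
  by apply/seteqP; split => x /= /(unit_sphere_mxact _ Qo).
rewrite -[in LHS]QD.
rewrite -(@integral_pushforward _ _ _ _ _ _ mQ nu D (EFin \o f))//.
- apply: eq_measure_integral => A mA _; case: nu_unif => _; exact.
- exact/measurable_EFinP.
- rewrite QD; apply: (@sphere_integrable _ M); first exact: measurableT_comp.
  by move=> x Dx; apply: fM; apply/unit_sphere_mxact.
Qed.

Let mU i : measurable_fun setT (fun x : n.-tuple R => tnth x i).
Proof. exact: measurable_tnth. Qed.

Lemma sphere_coord_le1 i x : D x -> `|tnth x i| <= 1.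
Proof.
by move=> /(unit_sphere_le1 i); rewrite -(real_normK (num_real _)) expr_le1.
Qed.

Lemma sphere_monomial_le1 i j k l x : D x -> `|tnth x i ^+ k * tnth x j ^+ l| <= 1.
Proof.
by move=> Dx; rewrite normrM !normrX mulr_ile1// exprn_ile1// sphere_coord_le1.
Qed.

Lemma sphere_monomial_integrable i j k l :
  nu.-integrable D (EFin \o (fun x => tnth x i ^+ k * tnth x j ^+ l)).
Proof.
apply: (@sphere_integrable _ 1); last exact: sphere_monomial_le1.
by apply: measurable_funM; apply: measurable_funX.
Qed.

Definition sphere_moment i k : R := EE (fun x => tnth x i ^+ k).

(** Rotate [u] to the axis [i]. The power is even so that the right-hand side is polynomial in
    [u]. *)
Lemma sphere_moment_inner i k (u : n.-tuple R) :
  EE (fun x => inner u x ^+ k.*2) = inner u u ^+ k * sphere_moment i k.*2.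
Proof.
have mp : measurable_fun setT (fun x : n.-tuple R => tnth x i ^+ k.*2).
  exact: measurable_funX.
have pM x : D x -> `|tnth x i ^+ k.*2| <= 1.
  by move=> Dx; rewrite normrX exprn_ile1// sphere_coord_le1.
have pI : nu.-integrable D (EFin \o (fun x => tnth x i ^+ k.*2)).
  exact: (sphere_integrable mp pM).
have Q0 := householder_orthogonal (vsub u (vscale (enorm u) (ebase i))).
set Q := householder _ in Q0.
have Qu : mxact Q u = vscale (enorm u) (ebase i).
  by apply: householder_swap; rewrite !inner_simp inner_ebase eqxx mulr1 -expr2 enorm_sqr.
rewrite /sphere_moment -(sphere_rotation Q0 mp pM) -RintegralZl//; last first.
  apply: (@sphere_integrable _ 1).
    exact: (measurableT_comp mp (measurable_mxact _ _)).
  by move=> x Dx; apply: pM; apply/unit_sphere_mxact.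
apply: eq_Rintegral => x _; rewrite -(inner_mxact u x Q0) Qu inner_vscalel.
by rewrite inner_ebasel exprMn -enorm_sqr -exprM mul2n.
Qed.

(** For u = e_i + t e_j, the mean of <u, x>^{2k+2} is (1 + t^2)^{k+1} times the pure moment, for
    every real t. Both sides are polynomials in t; the coefficients of t^2 are 'C(2k+2, 2) =
    (2k+1)(k+1) times the mixed moment and (k+1) times the pure one. *)
Lemma sphere_moment_mixed i j k : i != j ->
  (k.+1.*2).-1%:R * EE (fun x => tnth x i ^+ k.*2 * tnth x j ^+ 2) =
  sphere_moment i k.+1.*2.
Proof.
move=> ij; pose c l := EE (fun x => tnth x i ^+ (k.+1.*2 - l) * tnth x j ^+ l).
pose p : {poly R} := \poly_(l < k.+1.*2.+1) (c l *+ 'C(k.+1.*2, l)).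
pose q : {poly R} := sphere_moment i k.+1.*2 *: (1 + 'X^2) ^+ k.+1.
have pq : p = q.
  apply/eqP; rewrite -subr_eq0; apply/eqP/horner_ext_eq0 => t.
  rewrite hornerD hornerN; apply/eqP; rewrite subr_eq0; apply/eqP.
  pose u : n.-tuple R := vsub (ebase i) (vscale (- t) (ebase j)).
  have uu : inner u u = 1 + t ^+ 2.
    by rewrite !inner_simp !inner_ebase !eqxx (eq_sym j i) (negbTE ij) /=; ring.
  have ux x : inner u x = tnth x i + t * tnth x j.
    by rewrite !inner_simp !inner_ebasel; ring.
  rewrite /q hornerZ horner_exp hornerD hornerXn hornerC mulrC -uu.
  rewrite -sphere_moment_inner /p horner_poly.
  have cE l : t ^+ l * c l *+ 'C(k.+1.*2, l) =
    EE (fun x => (t ^+ l *+ 'C(k.+1.*2, l)) * (tnth x i ^+ (k.+1.*2 - l) * tnth x j ^+ l)).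
    by rewrite RintegralZl ?mulrnAl//; exact: sphere_monomial_integrable.
  transitivity (\sum_(l < k.+1.*2.+1) EE (fun x =>
     (t ^+ l *+ 'C(k.+1.*2, l)) * (tnth x i ^+ (k.+1.*2 - l) * tnth x j ^+ l))).
    by apply: eq_bigr => l _; rewrite -cE mulrC mulrnAr.
  rewrite -Rintegral_sum//; last first.
    move=> l; apply: (@sphere_integrable _ `|t ^+ l *+ 'C(k.+1.*2, l)|).
      by apply: measurable_funM => //; apply: measurable_funM; apply: measurable_funX.
    move=> x Dx; rewrite normrM -[leRHS]mulr1 ler_wpM2l//.
    exact: sphere_monomial_le1.
  apply: eq_Rintegral => x _; rewrite ux exprDn; apply: eq_bigr => l _.
  by rewrite exprMn mulrnAl mulrCA.
have := congr1 (fun r : {poly R} => r`_2) pq.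
rewrite coefZ coef_poly doubleS ltnS ltnS ltnS leq0n.
have -> : ((1 + 'X^2) ^+ k.+1 : {poly R})`_2 = k.+1%:R.
  rewrite exprDn coef_sum (bigD1 (Ordinal (isT : 1 < k.+2)%N))//= big1 => [|l l1].
    by rewrite expr1n mul1r expr1 bin1 coefMn coefXn eqxx addr0.
  rewrite expr1n mul1r coefMn -exprM coefXn.
  rewrite (_ : 2 == 2 * l = false)%N ?mul0rn//; apply/negbTE.
  by move: l1; apply: contra => /eqP l1; apply/eqP/val_inj => /=; lia.
have -> : 'C(k.*2.+2, 2) = ((k.*2).+1 * k.+1)%N.
  by rewrite bin2 -doubleS -doubleMl doubleK mulnC doubleS.
rewrite /c doubleS !subSS subn0 -[X in X = _]mulr_natr natrM mulrA => /mulIf <-.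
  by rewrite mulrC.
by rewrite pnatr_eq0.
Qed.

Lemma sphere_moment0 i : sphere_moment i 0 = 1.
Proof.
rewrite /sphere_moment; under eq_Rintegral do rewrite expr0.
by rewrite Rintegral_cst//= mul1r -[RHS]/(fine 1%:E); congr fine.
Qed.

(** Multiply x_i^{2k} by 1 = |x|^2 and integrate: each of the n - 1 mixed terms is the moment of
    order 2k + 2 divided by 2k + 1. *)
Lemma sphere_moment_recursion i k :
  (n + k.*2)%:R * sphere_moment i k.+1.*2 = (k.*2).+1%:R * sphere_moment i k.*2.
Proof.
have E : \sum_(j < n | j != i) EE (fun x => tnth x i ^+ k.*2 * tnth x j ^+ 2) =
    sphere_moment i k.*2 - sphere_moment i k.+1.*2.
  rewrite /sphere_moment -RintegralB//; last 2 first.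
  - by have := sphere_monomial_integrable i i k.*2 0;
      apply: eq_integrable => // x _ /=; rewrite expr0 mulr1.
  - by have := sphere_monomial_integrable i i k.+1.*2 0;
      apply: eq_integrable => // x _ /=; rewrite expr0 mulr1.
  rewrite -big_filter -Rintegral_sum//; last by move=> j; exact: sphere_monomial_integrable.
  apply: eq_Rintegral => x; rewrite inE => /unit_sphere_inner x1.
  rewrite big_filter -mulr_sumr doubleS -[(k.*2).+2]addn2 exprD.
  rewrite -[X in X - _]mulr1 -mulrBr -x1; congr (_ * _).
  rewrite /inner [in RHS](bigD1 i)//= -expr2 addrC addrK.
  by apply: eq_bigr => j _; rewrite expr2.
have : (k.+1.*2).-1%:R * (sphere_moment i k.*2 - sphere_moment i k.+1.*2) =
    n.-1%:R * sphere_moment i k.+1.*2.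
  rewrite -E mulr_sumr (eq_bigr (fun=> sphere_moment i k.+1.*2)) => [|j ji].
    rewrite sumr_const (_ : #|_| = n.-1); first by rewrite mulr_natl.
    by rewrite cardC1 card_ord.
  by rewrite sphere_moment_mixed// eq_sym.
rewrite doubleS /= mulrBr => /eqP; rewrite subr_eq -mulrDl -natrD => /eqP ->.
by congr (_%:R * _); have := ltn_ord i; lia.
Qed.

Lemma sphere_moment_ge0 i k : 0 <= sphere_moment i k.*2.
Proof.
by apply: Rintegral_ge0 => x _; rewrite -muln2 exprM exprn_even_ge0.
Qed.

(** The recursion makes the moment a product of ratios (2j+1) / (n+2j). With [h] half the dimension,
    rounded up, it compares factor by factor with the inverse of a binomial coefficient. *)
Lemma sphere_moment_lb i k h : (n <= h.*2)%N ->
  1 <= sphere_moment i k.+1.*2 * k.+1.*2%:R * 'C(h + k.+1, k.+1)%:R.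
Proof.
move=> nh; have n0 : (0 < n)%N by exact: leq_ltn_trans (ltn_ord i).
elim: k => [|k IH].
  have := sphere_moment_recursion i 0; rewrite sphere_moment0 mulr1 addn0.
  rewrite mulrC => /(canRL (mulfK _)) ->; last by rewrite pnatr_eq0 -lt0n.
  rewrite bin1 mul1r mulrAC -mulrA mulrC ler_pdivlMr ?ltr0n// mul1r -natrM ler_nat; lia.
apply: le_trans IH _.
set m := sphere_moment i _; have := sphere_moment_recursion i k.+1; rewrite -/m.
have nk : (n + k.+1.*2)%:R != 0 :> R by rewrite pnatr_eq0; lia.
rewrite mulrC => /(canRL (mulfK nk)) ->.
have bE : ('C(h + k.+2, k.+2) * k.+2 = (h + k.+2) * 'C(h + k.+1, k.+1))%N.
  by rewrite mulnC addnS mul_bin_diag.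
have {}bE : ('C(h + k.+2, k.+2)%:R * k.+2.*2%:R : R) =
    (h + k.+2).*2%:R * 'C(h + k.+1, k.+1)%:R.
  by rewrite -!natrM -!muln2 mulnA bE mulnAC.
rewrite -[leRHS]mulrA [X in _ <= _ * X]mulrC bE.
have m0 : 0 <= m by exact: sphere_moment_ge0.
rewrite [leLHS](_ : _ = (m * 'C(h + k.+1, k.+1)%:R) * (k.+1.*2%:R)); last by rewrite mulrAC.
rewrite [leRHS](_ : _ = (m * 'C(h + k.+1, k.+1)%:R) *
   ((k.+1.*2.+1)%:R / (n + k.+1.*2)%:R * (h + k.+2).*2%:R)); last by rewrite mulrACA; ring.
rewrite ler_wpM2l ?mulr_ge0//.
rewrite mulrAC ler_pdivlMr; last by rewrite ltr0n; lia.
rewrite -!natrM ler_nat; nia.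
Qed.

(** A single term of the expansion of (1 - p + p)^{h+k+1} = 1 bounds the binomial coefficient from
    above. The parameter [p] will be the tilted mean. *)
Lemma sphere_moment_exp_lb i k h (p : R) : (n <= h.*2)%N -> 0 <= p <= 1 ->
  p ^+ k.+1 * (1 - p) ^+ h <= sphere_moment i k.+1.*2 * k.+1.*2%:R.
Proof.
move=> nh /andP[p0 p1]; have q0 : 0 <= 1 - p by lra.
have C0 : 0 < 'C(h + k.+1, k.+1)%:R :> R by rewrite ltr0n bin_gt0 leq_addl.
rewrite -(ler_pM2r C0); apply: le_trans (sphere_moment_lb i k nh).
have E : (1 - p + p) ^+ (h + k.+1) = 1 by rewrite subrK expr1n.
rewrite -[leRHS]E.
have ik : (inord k.+1 : 'I_(h + k.+1).+1) = k.+1 :> nat by rewrite inordK//; lia.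
rewrite [leRHS]exprDn (bigD1 (inord k.+1))//= ik.
rewrite addnK mulr_natr [p ^+ _ * _]mulrC lerDl sumr_ge0// => l _.
by rewrite mulrn_wge0// mulr_ge0// exprn_ge0.
Qed.

End uniform_sphere.

(** * Mass of a spherical cap by tilting with an even power of the coordinate *)

Section sphere_cap.
Context {R : realType} {n : nat} (nu : probability (n.-tuple R) R).
Hypothesis nu_unif : uniform_sphere_law nu.
Local Notation D := (unit_sphere : set (n.-tuple R)).
Variables (i : 'I_n) (k : nat).
Local Notation N := (n%:R : R).
Local Notation K := (k.+1.*2%:R : R).

(* Mean of the square of a coordinate under the law with density proportional
   to its power of order 2k+2. *)
Definition tilted_mean : R := (K + 1) / (N + K).

Let N1 : 1 <= N. Proof. by rewrite ler1n; exact: leq_ltn_trans (ltn_ord i). Qed.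

Let K2 : 2 <= K. Proof. by rewrite ler_nat. Qed.

Lemma tilted_mean_gt0 : 0 < tilted_mean.
Proof. by rewrite divr_gt0//; lra. Qed.

Lemma onem_tilted_mean : 1 - tilted_mean = (N - 1) / (N + K).
Proof. by rewrite /tilted_mean; field; rewrite gt_eqF//; lra. Qed.

Lemma tilted_mean_le1 : tilted_mean <= 1.
Proof. by rewrite -subr_ge0 onem_tilted_mean divr_ge0//; have := N1; have := K2; lra. Qed.

Local Notation mu := tilted_mean.

Lemma sphere_moment_tilted : sphere_moment nu i k.+2.*2 = mu * sphere_moment nu i k.+1.*2.
Proof.
have := sphere_moment_recursion nu_unif i k.+1.
rewrite natrD -[(k.+1.*2).+1]addn1 natrD mulrC.
have NK : N + K != 0 by rewrite gt_eqF//; lra.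
by move=> /(canRL (mulfK NK)) ->; rewrite /mu mulrAC.
Qed.

(** Read under the tilted law, the squared coordinate has variance 2 mu (1 - mu) / (N + K + 2), at
    most 1 / (2 N). *)
Lemma sphere_moment_tilted2 : sphere_moment nu i k.+3.*2 =
  (mu + 2 * (1 - mu) / (N + K + 2)) * mu * sphere_moment nu i k.+1.*2.
Proof.
have := sphere_moment_recursion nu_unif i k.+2.
rewrite sphere_moment_tilted natrD (_ : (k.+2.*2).+1%:R = K + 3); last first.
  by rewrite -[3]/(3%:R) -natrD addn3.
rewrite (_ : k.+2.*2%:R = K + 2); last by rewrite -[2]/(2%:R) -natrD addn2.
have NK : N + (K + 2) != 0 by rewrite gt_eqF//; lra.
rewrite mulrC => /(canRL (mulfK NK)) ->.
rewrite onem_tilted_mean /mu; field; rewrite !gt_eqF//; lra.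
Qed.

(** Chebyshev's inequality under the tilted law, on a window of half-width 1 / sqrt n: the variance
    bound leaves at least half of the tilted mass inside, and there the tilting density is at most
    (mu + dl)^{k+1} up to normalisation. *)
Lemma sphere_cap_sqr_lb h (dl : R) : (n <= h.*2)%N -> 0 < dl -> dl ^+ 2 * N = 1 ->
  ((mu ^+ k.+1 * (1 - mu) ^+ h / (2 * K * (mu + dl) ^+ k.+1))%:E <=
    nu [set x | (mu - dl <= tnth x i ^+ 2)%R])%E.
Proof.
move=> nh dl0 dlN.
have mu0 := tilted_mean_gt0; have mu1 := tilted_mean_le1.
set L := (mu + dl) ^+ k.+1.
have L0 : 0 < L by rewrite exprn_gt0// addr_gt0.
pose A := [set x : n.-tuple R | mu - dl <= tnth x i ^+ 2].
have mA : measurable A.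
  rewrite -[A]setTI; apply: (measurable_fun_le (f := fun=> mu - dl)) => //.
  by apply: measurable_funX; exact: measurable_tnth.
pose a : R := (1 - mu ^+ 2 / dl ^+ 2) / L; pose b : R := 2 * mu / dl ^+ 2 / L.
pose c : R := - (dl ^+ 2)^-1 / L.
pose w (x : n.-tuple R) := tnth x i ^+ 2.
(* With w the squared coordinate, this is w^{k+1} / L times 1 - (w - mu)^2 / dl^2: nonpositive
   outside the window and at most 1 inside, hence below the indicator, while only three moments are
   needed to integrate it. *)
pose p (x : n.-tuple R) := (a * tnth x i ^+ k.+1.*2 + b * tnth x i ^+ k.+2.*2) + c * tnth x i ^+ k.+3.*2.
have pE x : p x = w x ^+ k.+1 / L * (1 - (w x - mu) ^+ 2 / dl ^+ 2).
  rewrite /p /w /a /b /c -!mul2n !exprM !exprS.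
  by field; rewrite !gt_eqF.
have pA x : D x -> p x <= \1_A x.
  move=> Dx; have w0 : 0 <= w x by rewrite sqr_ge0.
  have wL : 0 <= w x ^+ k.+1 / L by apply: divr_ge0; [exact: exprn_ge0|exact: ltW].
  have d2 : 0 < dl ^+ 2 by rewrite exprn_gt0.
  rewrite pE; have [far|near] := leP (dl ^+ 2) ((w x - mu) ^+ 2).
    apply: (@le_trans _ _ 0); last by rewrite indicE.
    by rewrite mulr_ge0_le0// subr_le0 ler_pdivlMr// mul1r.
  have : `|w x - mu| < dl.
    by rewrite -(ltr_pXn2r (n:=2))// ?nnegrE ?ltW// real_normK ?num_real.
  rewrite ltr_norml => /andP[lo hi].
  rewrite indicE mem_set /=; last by rewrite /A/=; rewrite -/(w x); lra.
  apply: mulr_ile1 => //.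
  - by rewrite subr_ge0 ler_pdivrMr// mul1r ltW.
  - rewrite ler_pdivrMr// mul1r /L; apply: lerXn2r; rewrite ?nnegrE//; lra.
  - by rewrite gerBl divr_ge0// ?sqr_ge0// ltW.
have mD : measurable D by exact: measurable_unit_sphere.
have mono l : nu.-integrable D (EFin \o (fun x => tnth x i ^+ l)).
  have := sphere_monomial_integrable nu i i l 0.
  by apply: eq_integrable => // x _ /=; rewrite expr0 mulr1.
have monoZ r l : nu.-integrable D (EFin \o (fun x => r * tnth x i ^+ l)).
  have := integrableZl mD r (mono l); apply: eq_integrable => // x _ /=.
have monoD r1 l1 r2 l2 :
    nu.-integrable D (EFin \o (fun x => r1 * tnth x i ^+ l1 + r2 * tnth x i ^+ l2)).
  have := integrableD mD (monoZ r1 l1) (monoZ r2 l2); apply: eq_integrable => // x _ /=.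
have pI : nu.-integrable D (EFin \o p).
  have := integrableD mD (monoD a k.+1.*2 b k.+2.*2) (monoZ c k.+3.*2).
  by apply: eq_integrable => // x _ /=.
have Ep : \int[nu]_(x in D) p x <= fine (nu A).
  apply: (@le_trans _ _ (\int[nu]_(x in D) \1_A x)).
    apply: le_Rintegral => //; apply: (@sphere_integrable _ _ nu _ 1).
      exact: measurable_indic.
    by move=> x _; rewrite indicE normr_nat lern1 leq_b1.
  rewrite /Rintegral integral_indic//; apply: fine_le.
  - by rewrite fin_num_measure//; exact: measurableI.
  - exact: fin_num_measure.
  - by apply: le_measure; rewrite ?inE//; exact: measurableI.
have EpE : \int[nu]_(x in D) p x = a * sphere_moment nu i k.+1.*2 +
    b * sphere_moment nu i k.+2.*2 + c * sphere_moment nu i k.+3.*2.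
  by rewrite RintegralD// RintegralD// !RintegralZl.
rewrite -[leRHS]fineK ?fin_num_measure// lee_fin; apply: le_trans Ep.
rewrite EpE sphere_moment_tilted sphere_moment_tilted2.
have := sphere_moment_exp_lb nu_unif i k nh; rewrite -/mu => /(_ mu).
rewrite (ltW mu0) mu1 => /(_ isT).
set m := sphere_moment _ _ _; set e := _ * _ ^+ h => em.
have d2 : dl ^+ 2 = N^-1.
  by apply: (mulIf (lt0r_neq0 (lt_le_trans ltr01 N1))); rewrite dlN mulVf// gt_eqF// (lt_le_trans ltr01 N1).
have -> : a * m + b * (mu * m) + c * ((mu + 2 * (1 - mu) / (N + K + 2)) * mu * m) =
   m * (1 - 2 * (mu * (1 - mu)) * (N / (N + K + 2))) / L.
  rewrite /a /b /c d2 invrK.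
  by field; rewrite (gt_eqF L0)/= gt_eqF//; have := N1; have := K2; lra.
rewrite (invfM (2 * K) L) [leLHS]mulrA ler_wpM2r ?invr_ge0 ?(ltW L0)//.
have K0 : 0 < K by exact: lt_le_trans K2.
have m0 : 0 <= m.
  by rewrite -(pmulr_lge0 _ K0) (le_trans _ em)// mulr_ge0// exprn_ge0// ?(ltW mu0)// subr_ge0.
rewrite ler_pdivrMr ?mulr_gt0// ?ltr0n//.
apply: le_trans em _.
have q1 : N / (N + K + 2) <= 1 by rewrite ler_pdivrMr ?mul1r; have := N1; lra.
have q0 : 0 <= N / (N + K + 2) by rewrite divr_ge0//; have := N1; lra.
move: (N / _) q1 q0 => q q1 q0.
have mm : mu * (1 - mu) <= 1/4 by have := sqr_ge0 (mu - 1/2); nra.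
have mm0 : 0 <= mu * (1 - mu) by rewrite mulr_ge0 ?(ltW mu0)// subr_ge0.
have h1 : mu * (1 - mu) * q <= 1/4 by nra.
have h2 : 0 <= m * K by rewrite mulr_ge0// ltW.
rewrite (_ : m * _ * (2 * K) = (m * K) * (2 * (1 - 2 * (mu * (1 - mu)) * q))); last by ring.
by rewrite -[leLHS]mulr1 ler_wpM2l//; lra.
Qed.
End sphere_cap.
Arguments tilted_mean {R} n k.

Section sphere_law.
Context {R : realType} {n : nat} (nu : probability (n.-tuple R) R).
Hypothesis nu_unif : uniform_sphere_law nu.
Implicit Types (i j : 'I_n).

Lemma sphere_inner_law (u : n.-tuple R) i (A : set R) : inner u u = 1 -> measurable A ->
  nu [set x | A (inner u x)] = nu [set x | A (tnth x i)].
Proof.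
move=> u1 mA; have [Q Q0 Qu] := rotation_to_ebase i u1.
rewrite -(nu_unif.2 Q Q0 [set x | A (tnth x i)]); last first.
  by rewrite -[X in measurable X]setTI; exact: measurable_tnth.
congr (nu _); apply/seteqP; split => x /=;
  by rewrite -(inner_mxact u x Q0) Qu inner_ebasel.
Qed.

(** Invariance makes the coordinate symmetric, so one cap has at least half the mass of the two
    opposite ones: hence 4 in place of 2. *)
Lemma sphere_cap_lb i k h (dl t : R) : (n <= h.*2)%N -> 0 < dl -> dl ^+ 2 * n%:R = 1 ->
  0 <= t -> t ^+ 2 <= tilted_mean n k - dl ->
  ((tilted_mean n k ^+ k.+1 * (1 - tilted_mean n k) ^+ h /
     (4 * k.+1.*2%:R * (tilted_mean n k + dl) ^+ k.+1))%:E <=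
    nu [set x | (t <= tnth x i)%R])%E.
Proof.
move=> nh dl0 dln t0 tmu; set m := tilted_mean n k in tmu *.
have mc (f : n.-tuple R -> R) : measurable_fun setT f -> measurable [set x | t <= f x].
  by move=> mf; rewrite -[X in measurable X]setTI; exact: measurable_fun_le.
have mt : measurable_fun setT (fun x : n.-tuple R => tnth x i) by exact: measurable_tnth.
have mN : measurable_fun setT (fun x : n.-tuple R => - tnth x i) by exact: measurable_funN.
have sym : nu [set x | t <= - tnth x i] = nu [set x | t <= tnth x i].
  have u1 : inner (vscale (-1) (ebase i)) (vscale (-1) (ebase i)) = 1 :> R.
    by rewrite !inner_simp inner_ebase eqxx /=; ring.
  rewrite -[RHS](@sphere_inner_law _ i [set y | t <= y] u1); last first.
    by rewrite -[X in measurable X]setTI; exact: measurable_fun_le.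
  by congr (nu _); apply/seteqP; split => x /=; rewrite inner_vscalel inner_ebasel mulN1r.
have le2 : (nu [set x | (m - dl <= tnth x i ^+ 2)%R] <=
    nu [set x | (t <= tnth x i)%R] + nu [set x | (t <= tnth x i)%R])%E.
  rewrite -[X in (_ + X)%E]sym; apply: le_trans (measureU2 _ _ _); [|exact: mc..].
  apply: le_measure; rewrite ?inE.
  - rewrite -[X in measurable X]setTI; apply: measurable_fun_le => //.
    exact: measurable_funX.
  - by apply: measurableU; exact: mc.
  - move=> x /= mx; have : t <= `|tnth x i|.
      rewrite -(ler_pXn2r (n:=2))// ?nnegrE// real_normK ?num_real//.
      exact: le_trans tmu mx.
    by rewrite ler_normr => /orP.
have := le_trans (sphere_cap_sqr_lb nu_unif i k nh dl0 dln) le2.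
have fA : nu [set x | t <= tnth x i] \is a fin_num by apply: fin_num_measure; exact: mc.
rewrite -/m -(fineK fA) -EFinD !lee_fin => h2.
rewrite [leLHS](_ : _ = 1 / 2 * (m ^+ k.+1 * (1 - m) ^+ h / (2 * k.+1.*2%:R * (m + dl) ^+ k.+1))).
  by lra.
have m0 : 0 < m by apply: tilted_mean_gt0.
have m1 : m + dl != 0 by rewrite gt_eqF// addr_gt0.
by field; rewrite expf_neq0// pnatr_eq0.
Qed.

(* For t <> 0 the lines <e_s, .> = t with e_s = (1 - s^2, 2 s) / (1 + s^2) in
   the plane of the coordinates i and j are all equally likely, and a point
   lies on at most two of them. *)
Lemma sphere_coord_atomless i j (t : R) : i != j -> t != 0 ->
  nu [set x | tnth x i = t] = 0%E.
Proof.
move=> ij t0.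
pose e (s : nat) : n.-tuple R := vscale (1 + s%:R ^+ 2)^-1
  (vsub (vscale (1 - s%:R ^+ 2) (ebase i)) (vscale (- 2 * s%:R) (ebase j))).
have s1 s : 0 < 1 + s%:R ^+ 2 :> R by rewrite ltr_pwDl// sqr_ge0.
have e1 s : inner (e s) (e s) = 1.
  rewrite !inner_simp !inner_ebase !eqxx (eq_sym j i) (negbTE ij) /=.
  by field; rewrite gt_eqF.
have ex s x : inner (e s) x = (1 + s%:R ^+ 2)^-1 *
    ((1 - s%:R ^+ 2) * tnth x i + 2 * s%:R * tnth x j).
  by rewrite !inner_simp !inner_ebasel; ring.
have mi u : measurable_fun setT (fun x : n.-tuple R => inner u x) by exact: measurable_inner.
have mA u : measurable [set x : n.-tuple R | inner u x = t].
  by rewrite -[X in measurable X]setTI; exact: (mi u measurableT [set t] (measurable_set1 t)).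
have nuA s : nu [set x | inner (e s) x = t] = nu [set x | tnth x i = t].
  exact: (@sphere_inner_law (e s) i [set t] (e1 s)).
have mT : measurable [set x : n.-tuple R | tnth x i = t].
  have := mA (ebase i); congr measurable.
  by apply/seteqP; split => x /=; rewrite inner_ebasel.
have bound m : (m%:R%:E * nu [set x | tnth x i = t] <= 2%:E)%E.
  have -> : (m%:R%:E * nu [set x | tnth x i = t] =
      \int[nu]_x \sum_(s < m) (\1_[set x | inner (e s) x = t] x)%:E)%E.
    rewrite ge0_integral_sum//; last first.
      by move=> s; apply/measurable_EFinP; exact: measurable_indic.
    rewrite (eq_bigr (fun=> nu [set x | tnth x i = t])) => [|s _]; last first.
      rewrite integral_indic; [|by []|exact: mA]; rewrite setIT; exact: nuA.
    by rewrite sumr_const card_ord -[RHS]mule_natl.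
  rewrite -(integral_probability_cst nu 2); apply: ge0_le_integral => //.
  - by move=> x _; apply: sume_ge0 => s _; rewrite lee_fin.
  - apply: emeasurable_sum => s; apply/measurable_EFinP; exact: measurable_indic.
  - move=> x _; rewrite sumEFin lee_fin.
    pose p := tnth x i; pose q := tnth x j.
    (* The equation <e_s, x> = t multiplied by 1 + s^2, as a quadratic in s. It is not identically
       zero: p - t and p + t cannot both vanish when t <> 0. *)
    pose r : {poly R} := Poly [:: p - t; 2 * q; - (p + t)].
    have rE y : r.[y] = (p - t) + 2 * q * y - (p + t) * y ^+ 2.
      by rewrite horner_Poly /=; ring.
    have r0 : r != 0.
      apply/eqP => r0; have := rE 0; have := rE 1; have := rE (-1).
      rewrite r0 !horner0 => h1 h2 h3; move/eqP: t0; lra.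
    have size_r : (size r <= 3)%N by exact: size_Poly.
    pose S := [seq s%:R : R | s <- iota 0 m & root r s%:R].
    have rS : all (root r) S by apply/allP => _ /mapP[s + ->]; rewrite mem_filter => /andP[].
    have uS : uniq S.
      rewrite map_inj_uniq ?filter_uniq ?iota_uniq// => a b /eqP.
      by rewrite eqr_nat => /eqP.
    have := max_poly_roots r0 rS uS; rewrite size_map size_filter.
    move=> /leq_trans /(_ size_r); rewrite ltnS => c2.
    rewrite (eq_bigr (fun s : 'I_m => (nat_of_bool (root r s%:R))%:R)) => [|s _].
      rewrite -natr_sum ler_nat; apply: leq_trans c2.
      rewrite -sum1_count [leqRHS]big_mkcond -(big_mkord xpredT (fun s => nat_of_bool (root r s%:R))).
      by rewrite /index_iota subn0 leq_sum// => s _; case: (root _ _).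
    rewrite indicE; congr (nat_of_bool _)%:R; rewrite /root rE.
    apply/idP/eqP => [|h]; rewrite inE /= ex -/p -/q.
      move/(canRL (mulVKf (lt0r_neq0 (s1 s)))) => h.
      rewrite -[RHS](subrr (t * (1 + s%:R ^+ 2))) {1}[t * _]mulrC -h; ring.
    apply: (canLR (mulKf (lt0r_neq0 (s1 s)))); rewrite -[RHS]addr0 -h; ring.
have fT : nu [set x | tnth x i = t] \is a fin_num by exact: fin_num_measure.
move: bound; rewrite -(fineK fT); set v := fine _ => bound.
have v0 : 0 <= v by rewrite fine_ge0.
congr EFin; apply/eqP; rewrite eq_le v0 andbT leNgt; apply/negP => vp.
have := bound (Num.truncn (2 / v)).+1; rewrite -EFinM lee_fin leNgt => /negP; apply.
by rewrite -ltr_pdivrMr// truncnS_gt.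
Qed.

End sphere_law.

(** * The random codebook *)

Section measurable_comparisons.
Context {d : measure_display} {T : measurableType d} {R : realType} (f g : T -> R).
Hypotheses (mf : measurable_fun setT f) (mg : measurable_fun setT g).

Lemma measurable_set_le : measurable [set x | f x <= g x].
Proof. by rewrite -[X in measurable X]setTI; exact: measurable_fun_le. Qed.

Lemma measurable_set_eq : measurable [set x | f x = g x].
Proof.
rewrite (_ : [set x | _] = (f \- g) @^-1` [set 0]); last first.
  by apply/seteqP; split => x /=; [move=> ->; rewrite subrr|exact: subr0_eq].
by rewrite -[X in measurable X]setTI; exact: (measurable_funB mf mg).
Qed.

End measurable_comparisons.

Lemma measurable_set_lt {d} {T : measurableType d} {R : realType} (f g : T -> R) :
  measurable_fun setT f -> measurable_fun setT g -> measurable [set x | f x < g x].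
Proof.
move=> mf mg; rewrite (_ : [set x | _] = ~` [set x | g x <= f x]).
  by apply: measurableC; exact: measurable_set_le.
by apply/seteqP; split => x /=; rewrite ltNge => /negP.
Qed.

Section codebook.
Context {R : realType} {n N : nat} (nu : probability (n.-tuple R) R).
Hypothesis nu_unif : uniform_sphere_law nu.
Variable mu : probability (N.-tuple (n.-tuple R)) R.
Hypothesis mu_nu : product_law (fun=> nu) mu.
Local Notation codebook := (N.-tuple (n.-tuple R)).
Implicit Types (i j : 'I_n) (a b : 'I_N) (xx : codebook).

Definition rotate_codebook (Q : 'M[R]_n) xx : codebook :=
  [tuple mxact Q (tnth xx a) | a < N].

Lemma measurable_rotate_codebook Q : measurable_fun setT (rotate_codebook Q).
Proof.
apply/measurable_fun_tnthP => a.
rewrite (_ : _ \o _ = fun xx => mxact Q (tnth xx a)); last first.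
  by apply/funext => xx /=; rewrite tnth_mktuple.
by apply: measurable_mxact; exact: measurable_tnth.
Qed.

HB.instance Definition _ Q :=
  isMeasurableFun.Build _ _ _ _ (rotate_codebook Q) (measurable_rotate_codebook Q).

Lemma codebook_rotation Q (A : set codebook) : Q *m Q^T = 1%:M -> measurable A ->
  mu (rotate_codebook Q @^-1` A) = mu A.
Proof.
move=> Q0 mA.
apply: (@product_law_unique _ _ _ _ (fun=> nu) (distribution mu (rotate_codebook Q)) mu) => //.
move=> B mB; rewrite /distribution /pushforward.
rewrite [LHS](_ : _ = mu [set xx | forall a, (mxact Q @^-1` B a) (tnth xx a)]); last first.
  by congr (mu _); apply/seteqP; split => xx /= h a; have := h a; rewrite ?tnth_mktuple.
rewrite [LHS](mu_nu (A:=fun a => mxact Q @^-1` B a)) => [|a]; last first.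
  by rewrite -[X in measurable X]setTI; exact: (measurable_mxact Q (@measurable_id _ _ setT)).
by apply: eq_bigr => a _; exact: nu_unif.2.
Qed.

Definition spherical : set codebook := [set xx | forall a, unit_sphere (tnth xx a)].

Lemma measurable_spherical : measurable spherical.
Proof. by apply: (@measurable_box _ _ _ (fun=> unit_sphere)) => a; exact: measurable_unit_sphere. Qed.

Lemma spherical_ae : mu (~` spherical) = 0%E.
Proof.
rewrite probability_setC; last exact: measurable_spherical.
have -> : mu spherical = 1%E.
  rewrite [LHS](mu_nu (A:=fun=> unit_sphere)) => [|a]; last exact: measurable_unit_sphere.
  by rewrite big1// => a _; exact: nu_unif.1.
by rewrite subee.
Qed.

Let mcoord a i : measurable_fun setT (fun xx => tnth (tnth xx a) i).
Proof.
exact: (measurableT_comp (@measurable_tnth _ _ _ i) (@measurable_tnth _ _ _ a)).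
Qed.

(** Positive height is required because level sets of a coordinate are shown to be null only at
    nonzero heights; on the good event the selected codeword has positive height. *)
Definition coord_tie i a b : set codebook :=
  [set xx | tnth (tnth xx a) i = tnth (tnth xx b) i /\ 0 < tnth (tnth xx a) i].

Lemma measurable_coord_tie i a b : measurable (coord_tie i a b).
Proof.
apply: measurableI; first exact: (measurable_set_eq (mcoord a i) (mcoord b i)).
exact: (@measurable_set_lt _ _ R (fun=> 0) _ (measurable_cst _) (mcoord a i)).
Qed.

Lemma coord_tie0 i j a b : i != j -> a != b -> mu (coord_tie i a b) = 0%E.
Proof.
move=> ij ab.
pose E : set (n.-tuple R * n.-tuple R) := [set z | tnth z.1 i = tnth z.2 i /\ 0 < tnth z.1 i].
have m1 : measurable_fun setT (fun z : n.-tuple R * n.-tuple R => tnth z.1 i).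
  exact: (measurableT_comp (@measurable_tnth _ R _ i)).
have m2 : measurable_fun setT (fun z : n.-tuple R * n.-tuple R => tnth z.2 i).
  exact: (measurableT_comp (@measurable_tnth _ R _ i)).
have mE : measurable E.
  apply: measurableI; first exact: (measurable_set_eq m1 m2).
  exact: (@measurable_set_lt _ _ R (fun=> 0) _ (measurable_cst _) m1).
have := @product_law_coord_pair _ _ _ _ (fun=> nu) mu mu_nu a b ab E mE.
rewrite /pushforward (_ : _ @^-1` E = coord_tie i a b)// => ->.
apply: integral0_eq => x _ /=.
have [x0|x0] := ltP 0 (tnth x i); last first.
  rewrite (_ : xsection E x = set0) ?measure0// -subset0 => y.
  by rewrite /xsection /= inE => -[_ /=]; rewrite ltNge x0.
rewrite (_ : xsection E x = [set y | tnth y i = tnth x i]).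
  by rewrite (sphere_coord_atomless nu_unif ij)// gt_eqF.
by apply/seteqP; split => y; rewrite /xsection/= inE; [case=> /= ->|move=> yx; split => /=].
Qed.

(** Strict maximality makes these events disjoint in [a]; sphericity bounds the sum of the squared
    coordinates on them. *)
Definition winner i a : set codebook := [set xx | spherical xx /\
  (forall b, b != a -> tnth (tnth xx b) i < tnth (tnth xx a) i)].

Lemma measurable_winner i a : measurable (winner i a).
Proof.
apply: measurableI; first exact: measurable_spherical.
rewrite [X in measurable X](_ : _ = \bigcap_(b in [set b | b != a])
  [set xx | tnth (tnth xx b) i < tnth (tnth xx a) i]); last first.
  by apply/seteqP; split => xx h b; apply: h.
apply: fin_bigcap_measurable => [|b _]; first exact: finite_finset.
exact: (measurable_set_lt (mcoord b i) (mcoord a i)).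
Qed.

Lemma winner_rotation Q i a : Q *m Q^T = 1%:M ->
  (forall x : n.-tuple R, tnth (mxact Q x) i = tnth x i) ->
  rotate_codebook Q @^-1` winner i a = winner i a.
Proof.
move=> Q0 Qi; apply/seteqP; split => xx [/= h1 h2]; split => b.
- by have := h1 b; rewrite tnth_mktuple unit_sphere_mxact.
- by move=> ba; have := h2 b ba; rewrite (tnth_mktuple _ b) (tnth_mktuple _ a) !Qi.
- by rewrite tnth_mktuple unit_sphere_mxact.
- by move=> ba; rewrite (tnth_mktuple _ b) (tnth_mktuple _ a) !Qi; exact: h2.
Qed.

Lemma mxact_tperm j l (x : n.-tuple R) i :
  tnth (mxact (tperm_mx j l) x) i = tnth x (tperm j l i).
Proof.
rewrite tnth_mktuple (bigD1 (tperm j l i))//= !mxE eqxx mul1r big1 ?addr0// => s si.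
by rewrite !mxE eq_sym (negbTE si) mul0r.
Qed.

(** Exchanging the coordinates [j] and [l] is an orthogonal map fixing coordinate [i], so it
    preserves the codebook law and the event. *)
Lemma winner_second_moment i j l a : i != j -> i != l ->
  (\int[mu]_(xx in winner i a) (tnth (tnth xx a) j ^+ 2)%:E =
   \int[mu]_(xx in winner i a) (tnth (tnth xx a) l ^+ 2)%:E)%E.
Proof.
move=> ij il; pose Q := tperm_mx j l : 'M[R]_n.
have Q0 : Q *m Q^T = 1%:M.
  by rewrite /Q /tperm_mx tr_perm_mx tpermV -perm_mxM tperm2 perm_mx1.
have Qi x : tnth (mxact Q x) i = tnth x i by rewrite mxact_tperm tpermD// eq_sym.
have mQ := measurable_rotate_codebook Q.
rewrite -[in LHS](winner_rotation a Q0 Qi).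
transitivity (\int[pushforward mu (rotate_codebook Q)]_(xx in winner i a)
   (tnth (tnth xx a) l ^+ 2)%:E)%E.
  rewrite (@ge0_integral_pushforward _ _ _ _ _ _ mQ mu (winner i a)).
  - by apply: eq_integral => xx _ /=; rewrite tnth_mktuple mxact_tperm tpermR.
  - exact: measurable_winner.
  - by apply/measurable_funTS/measurable_EFinP/measurable_funX.
  - by move=> xx _; rewrite lee_fin sqr_ge0.
by apply: eq_measure_integral => A mA _; exact: codebook_rotation.
Qed.

(** The n - 1 coordinates other than [i] have equal second moments, whose sum is at most the mass of
    the event. That mass is kept on the right: summed over [a] it costs 1, whereas a bound per
    codeword would cost the exponential size of the codebook. *)
Lemma winner_coord_bound i j a (eta : R) : i != j -> 0 < eta ->
  ((n.-1%:R)%:E * mu (winner i a `&` [set xx | (eta <= `|tnth (tnth xx a) j|)%R]) <=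
    (eta ^+ 2)^-1%:E * mu (winner i a))%E.
Proof.
move=> ij e0; have mW := measurable_winner i a.
have h : ((n.-1%:R)%:E * \int[mu]_(xx in winner i a) (tnth (tnth xx a) j ^+ 2)%:E <=
    mu (winner i a))%E.
  have -> : ((n.-1%:R)%:E * \int[mu]_(xx in winner i a) (tnth (tnth xx a) j ^+ 2)%:E =
      \sum_(l <- index_enum 'I_n | (l != i)%R)
        \int[mu]_(xx in winner i a) (tnth (tnth xx a) l ^+ 2)%:E)%E.
    rewrite (eq_bigr (fun=> \int[mu]_(xx in winner i a) (tnth (tnth xx a) j ^+ 2)%:E)%E).
      by rewrite sumr_const cardC1 card_ord -[RHS]mule_natl.
    by move=> l li; apply: winner_second_moment; rewrite // eq_sym.
  rewrite -big_filter -ge0_integral_sum//; last 2 first.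
  - by move=> l; apply/measurable_funTS/measurable_EFinP/measurable_funX.
  - by move=> l xx _; rewrite lee_fin sqr_ge0.
  rewrite -[leRHS]mul1e -integral_cst//; apply: ge0_le_integral => //.
  - by move=> xx _; apply: sume_ge0 => l _; rewrite lee_fin sqr_ge0.
  - apply: emeasurable_sum => l.
    by apply/measurable_funTS/measurable_EFinP/measurable_funX.
  - move=> xx [/(_ a)/unit_sphere_inner x1 _]; rewrite big_filter sumEFin lee_fin -x1.
    rewrite /inner [leRHS](bigD1 i)//= -[leLHS]add0r.
    apply: lerD; first by rewrite -expr2 sqr_ge0.
    by apply: ler_sum => l _; rewrite expr2.
have := markov_sqr mu mW (measurable_funTS (mcoord a j)) e0.
move=> /(lee_wpmul2l (_ : (0 <= (n.-1%:R)%:E)%E)) => /(_ (ltac:(by rewrite lee_fin))).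
move=> /le_trans; apply; rewrite muleCA lee_wpmul2l// lee_fin invr_ge0 sqr_ge0 //.
Qed.

Definition bad_winner i j (eta : R) : set codebook :=
  [set xx | spherical xx /\ exists a, [/\ 0 < tnth (tnth xx a) i,
     (forall b, tnth (tnth xx b) i <= tnth (tnth xx a) i) &
     eta <= `|tnth (tnth xx a) j|]].

(** A bad maximiser is either a strict winner or tied at positive height with another codeword; the
    ties form a null set. *)
Lemma bad_winner_bound i j (eta : R) : i != j -> 0 < eta ->
  measurable (bad_winner i j eta) ->
  (mu (bad_winner i j eta) <= ((n.-1%:R * eta ^+ 2)^-1)%:E)%E.
Proof.
move=> ij e0 mB.
pose W a := winner i a `&` [set xx | eta <= `|tnth (tnth xx a) j|].
have mW a : measurable (W a).
  apply: measurableI; first exact: measurable_winner.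
  apply: (@measurable_set_le _ _ R (fun=> eta) _ (measurable_cst _)).
  exact: (measurableT_comp _ (mcoord a j)).
pose TT a b := if b == a then set0 else coord_tie i a b.
have mTT a b : measurable (TT a b).
  by rewrite /TT; case: ifP => // _; exact: measurable_coord_tie.
have TT0 a b : mu (TT a b) = 0%E.
  by rewrite /TT; case: eqP => [_|/eqP ba]; rewrite ?measure0// (coord_tie0 ij)// eq_sym.
have sub : bad_winner i j eta `<=`
    \bigcup_(a in [set` index_enum 'I_N]) (W a `|` \bigcup_(b in [set` index_enum 'I_N]) TT a b).
  move=> xx [sp [a [a0 amax aeta]]]; exists a => //=; first by rewrite mem_index_enum.
  have [[b [ba eb]]|nt] := pselect (exists b, b != a /\ tnth (tnth xx a) i = tnth (tnth xx b) i).
    right; exists b => //=; first by rewrite mem_index_enum.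
    by rewrite /TT (negbTE ba).
  left; split => //; split => // b ba; rewrite lt_neqAle amax andbT.
  by apply/eqP => eb; apply: nt; exists b; split.
have Wdisj : trivIset [set` index_enum 'I_N] (fun a => winner i a).
  apply/trivIsetP => a b _ _ ab; rewrite -subset0 => xx [[_ ha] [_ hb]].
  have := ha b; rewrite eq_sym => /(_ ab) h1; have := hb a ab.
  by move=> /(lt_trans h1); rewrite ltxx.
have fin : finite_set [set` index_enum 'I_N] by exact: finite_seq.
have mTTU a : measurable (\bigcup_(b in [set` index_enum 'I_N]) TT a b).
  exact: fin_bigcup_measurable.
have TTU0 a : mu (\bigcup_(b in [set` index_enum 'I_N]) TT a b) = 0%E.
  apply/eqP; rewrite eq_le measure_ge0 andbT.
  have := content_sub_fsum mu fin (fun b _ => mTT a b) (mTTU a) (@subset_refl _ _).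
  by rewrite fsbig1// => b _; exact: TT0.
have le_sum : (mu (bad_winner i j eta) <= \sum_(a < N) mu (W a))%E.
  have mWU a : measurable (W a `|` \bigcup_(b in [set` index_enum 'I_N]) TT a b).
    exact: measurableU.
  apply: le_trans (content_sub_fsum mu fin (fun a _ => mWU a) mB sub) _.
  rewrite -fsbig_seq ?index_enum_uniq//; apply: lee_sum => a _.
  apply: le_trans (measureU2 _ _ _) _ => //.
  by rewrite [X in (_ + X)%E]TTU0 adde0.
have sum1 : (\sum_(a < N) mu (winner i a) <= 1)%E.
  have -> : (\sum_(a < N) mu (winner i a) =
      mu (\bigcup_(a in [set` index_enum 'I_N]) winner i a))%E.
    rewrite measure_fin_bigcup// => [|a _]; last exact: measurable_winner.
    by rewrite -fsbig_seq// index_enum_uniq.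
  apply: probability_le1; apply: fin_bigcup_measurable => // a _.
  exact: measurable_winner.
have n0 : 0 < n.-1%:R :> R.
  by rewrite ltr0n; move: ij; rewrite -val_eqE/=; have := ltn_ord i; have := ltn_ord j; lia.
apply: le_trans le_sum _.
rewrite -[leRHS]mule1 lee_pdivlMl; last by rewrite mulr_gt0// exprn_gt0.
apply: le_trans sum1; rewrite ge0_sume_distrr//; apply: lee_sum => a _.
have := winner_coord_bound a ij e0.
by rewrite lee_pdivlMl ?exprn_gt0// muleA -EFinM mulrC.
Qed.

End codebook.

(** * Spherical caps and codebook size *)

Lemma codebook_all_below {R : realType} {n N : nat} (nu : probability (n.-tuple R) R)
    (mu : probability (N.-tuple (n.-tuple R)) R) (i : 'I_n) (t p : R) :
  product_law (fun=> nu) mu -> (p%:E <= nu [set x | (t <= tnth x i)%R])%E ->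
  (mu [set xx | (forall a, tnth (tnth xx a) i < t)%R] <= (expR (- (N%:R * p)))%:E)%E.
Proof.
move=> mu_nu pnu.
have mA : measurable [set x : n.-tuple R | t <= tnth x i].
  apply: (@measurable_set_le _ _ R (fun=> t)) => //; exact: measurable_tnth.
have below : nu [set x | tnth x i < t] = (1 - nu [set x | (t <= tnth x i)%R])%E.
  rewrite -probability_setC//; congr (nu _).
  by apply/seteqP; split => x /=; rewrite ltNge => /negP.
have fA : nu [set x | t <= tnth x i] \is a fin_num by exact: fin_num_measure.
rewrite [X in (X <= _)%E](mu_nu (fun=> [set x | tnth x i < t])); last first.
  by move=> a; apply: (@measurable_set_lt _ _ R _ (fun=> t)) => //; exact: measurable_tnth.
rewrite below -(fineK fA) -EFinB; move: pnu; rewrite -(fineK fA) lee_fin.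
have : fine (nu [set x | t <= tnth x i]) <= 1.
  by rewrite -lee_fin fineK// probability_le1.
move: (fine _) => v v1 pv.
rewrite prodEFin prodr_const card_ord lee_fin -mulrN expRM_natl.
apply: lerXn2r; rewrite ?nnegrE ?expR_ge0//=; first lra.
by apply: le_trans (expR_ge1Dx _); lra.
Qed.

Lemma bernoulli_inequality (R : realType) (y : R) h : 0 <= y <= 1 ->
  1 - h%:R * y <= (1 - y) ^+ h.
Proof.
move=> /andP[y0 y1]; elim: h => [|h IH]; first by rewrite expr0; lra.
rewrite exprS; have : (1 - y) * (1 - h%:R * y) <= (1 - y) * (1 - y) ^+ h.
  by rewrite ler_wpM2l// subr_ge0.
apply: le_trans; rewrite -natr1.
have : 0 <= h%:R * y ^+ 2 by rewrite mulr_ge0 ?sqr_ge0//.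
nra.
Qed.

(** * Choice of the tilting exponent *)

Section cap_estimate.
Context {R : realType} (q : R) (n k h : nat).
Local Notation x := (n%:R : R).
Local Notation r := (Num.sqrt x).
Local Notation T := (k.+1.*2%:R : R).
Hypotheses (q0 : 0 < q) (q1 : q < 1) (n2 : (1 < n)%N).
Hypotheses (nh : (n <= h.*2)%N) (hn : (h.*2 <= n.+1)%N).
(** x + T = x / q would put the tilted mean near 1 - q. The deficit of order [r] lowers the mean by
    O(1 / r) only, but raises (1 - mu)^h by the factor expR (r / q). *)
Hypothesis T_le : x + T <= x / q - 2 / q ^+ 2 * r.
Local Notation mu := (tilted_mean n k : R).

Let x2 : 2 <= x. Proof. by rewrite ler_nat. Qed.
Let rr : r ^+ 2 = x. Proof. by rewrite sqr_sqrtr. Qed.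
Let r1 : 1 <= r.
Proof. by rewrite -[leLHS]sqrtr1 ler_sqrt; have := x2; lra. Qed.
Let xr : x / r = r.
Proof. by rewrite -{1}rr expr2 mulfK// gt_eqF//; have := r1; lra. Qed.
Let T2 : 2 <= T. Proof. by rewrite ler_nat. Qed.

(** The price of the window: (1 + 1 / (r mu))^{k+1} <= expR ((k+1) / (r mu)), and (k+1) / mu is at
    most x / (2 q). *)
Lemma tilted_mean_ratio_lb :
  expR (- (r / (2 * q))) <= mu ^+ k.+1 / (mu + r^-1) ^+ k.+1.
Proof.
have q0' := q0; have q1' := q1; have r1' := r1; have T2' := T2; have x2' := x2.
have mu0 : 0 < mu by rewrite divr_gt0//; lra.
have r0 : 0 < r^-1 by rewrite invr_gt0; lra.
rewrite -expr_div_n expRN -[leRHS]invrK lef_pV2 ?posrE ?expR_gt0 ?invr_gt0 ?exprn_gt0 ?divr_gt0 ?addr_gt0//.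
rewrite -exprVn invf_div.
apply: (@le_trans _ _ (expR (r^-1 / mu) ^+ k.+1)).
  apply: lerXn2r; rewrite ?nnegrE ?expR_ge0//.
    by apply: divr_ge0; lra.
  rewrite mulrDl divff ?(gt_eqF mu0)//.
  exact: expR_ge1Dx.
rewrite -expRM_natl ler_expR.
have -> : k.+1%:R * (r^-1 / mu) = (x + T) * (T / (T + 1)) / (2 * r).
  have -> : k.+1%:R = T / 2 :> R by rewrite -muln2 natrM mulfK.
  by rewrite /tilted_mean; field; rewrite !gt_eqF//; lra.
have xT : (x + T) * (T / (T + 1)) <= x / q.
  apply: (@le_trans _ _ (x + T)).
    by rewrite ler_piMr ?ler_pdivrMr//; lra.
  apply: le_trans T_le _; rewrite gerBl mulr_ge0 ?divr_ge0 ?sqr_ge0//; lra.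
rewrite ler_pdivrMr; last lra.
apply: le_trans xT _; rewrite -{1}rr le_eqVlt; apply/orP; left; apply/eqP; field.
  by rewrite gt_eqF.
lra.
Qed.

(** 1 - mu factors as (1 - 1/x) (x / (x + T)). Bernoulli's inequality leaves 1/4 of the first
    factor; the deficit in [T_le] makes the second at least q expR (2 / (q r)), and h >= x / 2. *)
Lemma onem_tilted_mean_pow_lb : q ^+ h * expR (r / q) / 4 <= (1 - mu) ^+ h.
Proof.
have q0' := q0; have q1' := q1; have r1' := r1; have T2' := T2; have x2' := x2.
have S0 : 0 < x + T by lra.
rewrite onem_tilted_mean (_ : (x - 1) / (x + T) = (1 - x^-1) * (x / (x + T))); last first.
  by field; rewrite !gt_eqF//; lra.
rewrite exprMn mulrC; apply: ler_pM => //.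
- by rewrite mulr_ge0 ?expR_ge0// exprn_ge0// ltW.
- have xV : 0 <= x^-1 <= 1 by rewrite invr_ge0 invf_le1; lra.
  apply: le_trans (bernoulli_inequality h xV).
  have : h%:R / x <= 3 / 4.
    rewrite ler_pdivrMr; last lra.
    have : 2 * h%:R <= x + 1 by rewrite -natrM natr1 ler_nat mul2n.
    lra.
  lra.
- have ub : q * expR (2 / q / r) <= x / (x + T).
    have e0 : expR (2 / q / r) * expR (- (2 / q / r)) = 1 by rewrite -expRD subrr expR0.
    rewrite ler_pdivlMr//.
    apply: (@le_trans _ _ (q * expR (2 / q / r) * (x / q * expR (- (2 / q / r))))).
      rewrite ler_wpM2l ?mulr_ge0 ?expR_ge0 ?(ltW q0)//.
      apply: le_trans T_le _.
      have -> : x / q - 2 / q ^+ 2 * r = x / q * (1 + - (2 / q / r)).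
        by rewrite -{2}xr; field; rewrite !gt_eqF//; lra.
      by rewrite ler_wpM2l ?expR_ge1Dx// divr_ge0 ?(ltW q0).
    rewrite mulrACA [q * _]mulrC divfK ?gt_eqF// e0; lra.
  apply: (@le_trans _ _ ((q * expR (2 / q / r)) ^+ h)).
    rewrite exprMn ler_wpM2l ?exprn_ge0 ?(ltW q0)// -expRM_natl ler_expR.
    have hx : x / 2 <= h%:R.
      by rewrite ler_pdivrMr// -natrM ler_nat muln2.
    apply: (@le_trans _ _ (x / 2 * (2 / q / r))).
      rewrite -[leLHS](_ : x / r / q = _); last by rewrite xr.
      by rewrite le_eqVlt; apply/orP; left; apply/eqP; field; rewrite !gt_eqF//; lra.
    by rewrite ler_wpM2r// !divr_ge0// ltW//; lra.
  by apply: lerXn2r; rewrite ?nnegrE// ?divr_ge0 ?mulr_ge0 ?expR_ge0 ?(ltW q0)// ltW.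
Qed.

(** Gain over price leaves expR (r / (2 q)), of which only the Taylor term of order 4 is kept: it is
    of order n^2, and after division by 4 T <= 4 x / q a factor n survives. In the constant, 24 is
    4! and 16 * 16 collects 2^4, the quarter and the 4 of 4 T. *)
Lemma cap_mass_lb :
  n%:R * q ^+ h / (16 * 16 * 24 * q ^+ 3) <=
  mu ^+ k.+1 * (1 - mu) ^+ h / (4 * T * (mu + r^-1) ^+ k.+1).
Proof.
have q0' := q0; have q1' := q1; have r1' := r1; have T2' := T2; have x2' := x2.
have Tq : T <= x / q.
  have : 0 <= 2 / q ^+ 2 * r by rewrite mulr_ge0 ?divr_ge0 ?sqr_ge0//; lra.
  have := T_le; lra.
have mur : 0 < mu + r^-1 by rewrite addr_gt0// ?invr_gt0; [exact: tilted_mean_gt0|lra].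
rewrite [leRHS](_ : _ = mu ^+ k.+1 / (mu + r^-1) ^+ k.+1 * (1 - mu) ^+ h / (4 * T)); last first.
  by field; rewrite expf_neq0 ?gt_eqF//=; lra.
have q4 : 0 < q ^+ h by rewrite exprn_gt0.
rewrite ler_pdivlMr; last lra.
apply: (@le_trans _ _ (expR (- (r / (2 * q))) * (q ^+ h * expR (r / q) / 4))); last first.
  apply: ler_pM; rewrite ?expR_ge0 ?divr_ge0 ?mulr_ge0 ?expR_ge0 ?(ltW q4)//.
  - exact: tilted_mean_ratio_lb.
  - exact: onem_tilted_mean_pow_lb.
rewrite (_ : _ * (_ / 4) = q ^+ h * (expR (r / (2 * q))) / 4); last first.
  rewrite (_ : r / q = r / (2 * q) + r / (2 * q)); last by field; rewrite gt_eqF.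
  rewrite expRD expRN; field; rewrite gt_eqF ?expR_gt0//.
have e4 : (r / (2 * q)) ^+ 4 / 24 <= expR (r / (2 * q)).
  have w0 : 0 <= r / (2 * q) by rewrite divr_ge0//; lra.
  have := expR_ge1Dxn 3 w0; rewrite (_ : 4`! = 24)%N//; lra.
apply: (@le_trans _ _ (q ^+ h * ((r / (2 * q)) ^+ 4 / 24) / 4)); last first.
  by rewrite ler_pM2r// ler_wpM2l// ltW.
apply: (@le_trans _ _ (x * q ^+ h / (16 * 16 * 24 * q ^+ 3) * (4 * (x / q)))).
  apply: ler_wpM2l; last lra.
  apply: divr_ge0; first by apply: mulr_ge0; [lra|exact: ltW].
  by rewrite ltW// pmulr_rgt0 ?exprn_gt0//; lra.
rewrite -[leRHS](_ : q ^+ h * ((r ^+ 2) ^+ 2 / (2 * q) ^+ 4 / 24) / 4 = _); last first.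
  by rewrite expr_div_n -exprM.
rewrite rr le_eqVlt; apply/orP; left; apply/eqP; field; rewrite gt_eqF//.
Qed.

(** In w = 2 / q + 2 q the first term is the deficit of [T] and the second absorbs the rounding of
    [T] to an even integer. Then 1 - mu <= q (1 + 2 w / r), from 1 / (1 - u) <= 1 + 2 u for u <=
    1/2; the final 1 of [C1] is the half-width of the window. *)
Lemma cap_height_lb (C1 : R) : C1 = 2 * q * (2 / q + 2 * q) + 1 ->
  x / q - 2 / q ^+ 2 * r - 2 <= x + T -> 2 * (2 / q + 2 * q) <= r ->
  1 - q - C1 / r <= mu - r^-1.
Proof.
move=> -> T_ge rq; have q0' := q0; have q1' := q1; have r1' := r1; have T2' := T2; have x2' := x2.
have S0 : 0 < x + T by lra.
set w := 2 / q + 2 * q in rq *.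
have w0 : 0 < w by rewrite addr_gt0 ?divr_gt0 ?mulr_gt0.
have S_ge : x / q * (1 - w / r) <= x + T.
  apply: le_trans T_ge; rewrite [leLHS](_ : _ = x / q - w / q * (x / r)); last by ring.
  rewrite xr (_ : w / q * r = 2 / q ^+ 2 * r + 2 * r); first lra.
  by rewrite /w; field; rewrite gt_eqF.
pose u := w / r; have u0 : 0 < u by rewrite divr_gt0//; lra.
have u12 : 2 * u <= 1 by rewrite /u mulrA ler_pdivrMr ?mul1r//; lra.
suff : 1 - mu <= q + 2 * q * u.
  have -> : (2 * q * w + 1) / r = 2 * q * u + r^-1.
    by rewrite /u; field; rewrite gt_eqF//; lra.
  lra.
rewrite onem_tilted_mean ler_pdivrMr//.
apply: (@le_trans _ _ ((q + 2 * q * u) * (x / q * (1 - u)))); last first.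
  have qu : 0 < q * u by rewrite mulr_gt0.
  by apply: ler_wpM2l; [lra|exact: S_ge].
rewrite [leRHS](_ : _ = x + x * (u * (1 - 2 * u))); last by field; rewrite gt_eqF.
have : 0 <= x * (u * (1 - 2 * u)) by rewrite !mulr_ge0//; lra.
lra.
Qed.

End cap_estimate.

Lemma uphalf_double_bounds n : (n <= (uphalf n).*2 <= n.+1)%N.
Proof. lia. Qed.

Lemma near_sqrt_ge (R : realType) (M : R) : \forall n \near \oo, M <= Num.sqrt n%:R.
Proof.
near=> n; apply: (@le_trans _ _ `|M|); first exact: ler_norm.
rewrite -sqrtr_sqr ler_sqrt//.
near: n; exact: nbhs_infty_ger.
Unshelve. all: by end_near. Qed.

(** The threshold in n is uniform over the sphere laws, since each sample size brings its own. *)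
Lemma cap_mass_asymptotics (R : realType) (B : R) : 0 < B ->
  exists C c0 : R, [/\ 0 < C, 0 < c0 & \forall n \near \oo,
  forall nu : probability (n.-tuple R) R, uniform_sphere_law nu ->
  forall i : 'I_n,
    let t := Num.sqrt (1 - 2 `^ (- (2 * B))) - C / Num.sqrt n%:R in
    0 < t /\ exists p : R, (p%:E <= nu [set x | (t <= tnth x i)%R])%E /\
      c0 * n%:R <= (codebook_size n B)%:R * p].
Proof.
move=> B0; set q := 2 `^ (- (2 * B)).
have q0 : 0 < q by rewrite powR_gt0.
have q1 : q < 1.
  rewrite /q /powR pnatr_eq0/= -[ltRHS]expR0 ltr_expR pmulr_llt0 ?ln_gt0 ?ltr1n//.
  by rewrite oppr_lt0 mulr_gt0.
pose beta := Num.sqrt (1 - q).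
have b2 : beta ^+ 2 = 1 - q by rewrite sqr_sqrtr// subr_ge0 ltW.
have b0 : 0 < beta by rewrite sqrtr_gt0 subr_gt0.
pose C1 := 2 * q * (2 / q + 2 * q) + 1.
have C10 : 0 < C1 by rewrite addr_gt0// ?mulr_gt0 ?addr_gt0 ?divr_gt0 ?mulr_gt0.
(* A loss of C1 / r on the squared height is a loss of order C1 / (beta r) on the height. In the
   second constant, 2^{-B} pays for rounding n / 2 up to [h] and the 2 for the integer part in the
   codebook size. *)
exists (C1 / beta), (2 `^ (- B) / (2 * (16 * 16 * 24 * q ^+ 3))).
split; first by rewrite divr_gt0.
  by rewrite divr_gt0 ?powR_gt0// !mulr_gt0// exprn_gt0.
near=> n; move=> nu nu_unif i.
have n2 : (1 < n)%N by near: n; exact: nbhs_infty_gt.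
have r1 : 1 <= Num.sqrt (n%:R : R) by near: n; exact: near_sqrt_ge.
have ra : (2 / q ^+ 2 + 4) / (q^-1 - 1) <= Num.sqrt n%:R by near: n; exact: near_sqrt_ge.
have rw : 2 * (2 / q + 2 * q) <= Num.sqrt n%:R by near: n; exact: near_sqrt_ge.
have rC : 2 * (C1 / beta) / beta <= Num.sqrt n%:R by near: n; exact: near_sqrt_ge.
have rr : Num.sqrt n%:R ^+ 2 = n%:R :> R by rewrite sqr_sqrtr.
pose x : R := n%:R; pose r := Num.sqrt x; rewrite -/x -/r in r1 ra rw rC rr *.
have x2 : 2 <= x by rewrite ler_nat.
have a0 : 0 < q^-1 - 1 by rewrite subr_gt0 invf_gt1.
(* Half the largest admissible [T]; [k.+1] is its integer part, so rounding costs at most 2 in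
   [T]. *)
pose y := (x / q - 2 / q ^+ 2 * r - x) / 2.
have y1 : 2 <= y.
  have : 2 / q ^+ 2 + 4 <= (q^-1 - 1) * r by rewrite [leRHS]mulrC -ler_pdivrMr.
  rewrite ler_pdivlMr// /y -rr => h.
  have : 4 <= r * ((q^-1 - 1) * r - 2 / q ^+ 2) by nra.
  lra.
have [k yk] : exists k, Num.truncn y = k.+1.
  by exists (Num.truncn y).-1; rewrite prednK// truncn_gt0; lra.
have y0 : 0 <= y by lra.
have := truncn_itv y0; rewrite yk => /andP[ky yk2].
have kE : k.+1.*2%:R = 2 * k.+1%:R :> R by rewrite -muln2 natrM mulrC.
have T_le : n%:R + k.+1.*2%:R <= n%:R / q - 2 / q ^+ 2 * Num.sqrt n%:R.
  by rewrite kE -/x -/r; move: ky; rewrite /y; lra.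
have T_ge : n%:R / q - 2 / q ^+ 2 * Num.sqrt n%:R - 2 <= n%:R + k.+1.*2%:R.
  by rewrite kE -/x -/r; move: yk2; rewrite -[k.+2]addn1 natrD /y; lra.
have /andP[nh hn] := uphalf_double_bounds n; set h := uphalf n in nh hn.
have Hh := cap_height_lb q0 q1 n2 (erefl C1) T_ge rw.
have Hm := cap_mass_lb q0 q1 n2 nh hn T_le.
rewrite -/x -/r in Hh Hm.
have r0 : 0 < r by lra.
have Cb : 2 * (C1 / beta / r) <= beta.
  by rewrite mulrA ler_pdivrMr// [leRHS]mulrC -ler_pdivrMr.
have C2 : 0 < C1 / beta / r by rewrite !divr_gt0.
set t := beta - _ => /=.
have t0 : 0 < t by rewrite /t; lra.
split => //.
set p := (X in _ <= X) in Hm; exists p; split.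
- have H := @sphere_cap_lb R n nu nu_unif i k h r^-1 t nh.
  apply: H => //.
  + by rewrite invr_gt0.
  + by rewrite -/x -/r exprVn rr mulVf// gt_eqF//; lra.
  + exact: ltW.
  (* For D = C1 / (beta r) <= beta, (beta - D)^2 <= beta^2 - beta D. *)
  + apply: le_trans Hh; rewrite -b2 /t.
    have -> : C1 / r = beta * (C1 / beta / r) by field; rewrite !gt_eqF.
    by move: Cb C2; set D := _ / r; nra.
- have p0 : 0 <= p.
    by apply: le_trans Hm; rewrite divr_ge0 ?mulr_ge0 ?exprn_ge0 ?(ltW q0)//; lra.
  have Ncb : 2 `^ (x * B) / 2 <= (codebook_size n B)%:R.
    rewrite /codebook_size -/x; set z := 2 `^ _.
    have z1 : 1 <= z.
      by rewrite -(powRr0 2) ler_powR ?ler1n// mulr_ge0// ltW//; lra.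
    have z0 : 0 <= z by lra.
    have := truncn_itv z0 => /andP[_]; rewrite -natr1.
    have : 1 <= (Num.truncn z)%:R :> R by rewrite ler1n truncn_gt0.
    lra.
  apply: le_trans (ler_wpM2r p0 Ncb).
  apply: (@le_trans _ _ (2 `^ (x * B) / 2 * (x * q ^+ h / (16 * 16 * 24 * q ^+ 3)))); last first.
    by rewrite ler_wpM2l// divr_ge0// powR_ge0.
  have qh : 2 `^ (- B) <= 2 `^ (x * B) * q ^+ h.
    rewrite -powR_mulrn ?powR_ge0// /q -powRrM -powRD; last by rewrite pnatr_eq0 implybT.
    rewrite ler_powR ?ler1n//.
    have : 2 * h%:R <= x + 1 by rewrite -natrM natr1 ler_nat mul2n.
    nra.
  rewrite [leRHS](_ : _ = 2 `^ (x * B) * q ^+ h / (2 * (16 * 16 * 24 * q ^+ 3)) * x); last first.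
    by field; rewrite gt_eqF.
  apply: ler_wpM2r; first lra.
  apply: ler_wpM2r qh; rewrite invr_ge0 ltW// !mulr_gt0// exprn_gt0//.
Unshelve. all: by end_near. Qed.

(** * Bad events *)

Section independence.
Context {d d1 d2 : measure_display} {T : measurableType d} {T1 : measurableType d1}
  {T2 : measurableType d2} {R : realType} {P : probability T R}
  (X : {RV P >-> T1}) (Y : {RV P >-> T2}).

Definition RV_pair (w : T) := (X w, Y w).

Lemma measurable_RV_pair : measurable_fun setT RV_pair.
Proof. by apply: measurable_fun_pair; exact: measurable_funPT. Qed.

HB.instance Definition _ := isMeasurableFun.Build _ _ _ _ _ measurable_RV_pair.

(** The joint law is the product measure; a bound uniform over the sections integrates to itself. *)
Lemma independent_rv_bound (E : set (T1 * T2)) (eps : R) : independent_rv X Y ->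
  measurable E -> (forall x, distribution P Y (xsection E x) <= eps%:E)%E ->
  (P [set w | E (X w, Y w)] <= eps%:E)%E.
Proof.
move=> ind mE Eeps.
have h := @product_measure_unique _ _ _ _ R (distribution P X) (distribution P Y)
  (distribution P RV_pair) ind E mE.
have -> : P [set w | E (X w, Y w)] = distribution P RV_pair E by [].
rewrite -h /product_measure1 -(integral_probability_cst (distribution P X) eps).
apply: ge0_le_integral => //; first exact: measurable_fun_xsection.
by move=> x _; exact: Eeps.
Qed.

End independence.

Section bad_events.
Context {R : realType} {n N : nat}.
Local Notation codebook := (N.-tuple (n.-tuple R)).
Variable theta : n.-tuple R.

(* |x|^2 times the component of theta orthogonal to x; scaling by |x|^2 avoids
   a division. *)
Definition transversal (x : n.-tuple R) : n.-tuple R :=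
  vsub (vscale (inner x x) theta) (vscale (inner theta x) x).

Lemma inner_transversal x : inner x (transversal x) = 0.
Proof. by rewrite /transversal !inner_simp (innerC x theta); ring. Qed.

Lemma enorm_transversal x : enorm (transversal x) <= inner x x * enorm theta.
Proof.
rewrite -(ler_pXn2r (n:=2))// ?nnegrE ?enorm_ge0 ?mulr_ge0 ?inner_ge0 ?enorm_ge0//.
rewrite exprMn !enorm_sqr /transversal !inner_simp (innerC x theta).
have := inner_ge0 x; have := sqr_ge0 (inner theta x); nra.
Qed.

(* Some maximiser of <x, .> over the codebook deviates in the direction of the
   component of theta orthogonal to x. *)
Definition transversal_event (eps : R) : set (n.-tuple R * codebook) :=
  [set z | spherical z.2 /\ exists a : 'I_N, [/\ 0 < inner z.1 (tnth z.2 a),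
    (forall b : 'I_N, inner z.1 (tnth z.2 b) <= inner z.1 (tnth z.2 a)) &
    eps * inner z.1 z.1 <= `|inner (transversal z.1) (tnth z.2 a)|]].

Definition low_correlation_event (t : R) : set (n.-tuple R * codebook) :=
  [set z | forall a : 'I_N, inner z.1 (tnth z.2 a) < t * enorm z.1].

Let mx : measurable_fun setT (fun z : n.-tuple R * codebook => z.1).
Proof. exact: measurable_fst. Qed.

Let mc (a : 'I_N) : measurable_fun setT (fun z : n.-tuple R * codebook => tnth z.2 a).
Proof. exact: (measurableT_comp (@measurable_tnth _ _ _ a) measurable_snd). Qed.

Lemma measurable_low_correlation_event t : measurable (low_correlation_event t).
Proof.
rewrite [X in measurable X](_ : _ = \bigcap_(a in [set: 'I_N])
  [set z | inner z.1 (tnth z.2 a) < t * enorm z.1]); last first.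
  by apply/seteqP; split => z h a => [_|]; apply: h.
apply: fin_bigcap_measurable => [|a _]; first exact: finite_finset.
apply: measurable_set_lt; first exact: measurable_inner.
by apply: measurable_funM => //; exact: measurable_enorm.
Qed.

Lemma measurable_transversal_event eps : measurable (transversal_event eps).
Proof.
apply: measurableI.
  by rewrite -[X in measurable X]setTI; apply: measurable_snd => //; exact: measurable_spherical.
rewrite [X in measurable X](_ : _ = \bigcup_(a in [set: 'I_N])
  ([set z | 0 < inner z.1 (tnth z.2 a)] `&`
   (\bigcap_(b in [set: 'I_N]) [set z | inner z.1 (tnth z.2 b) <= inner z.1 (tnth z.2 a)]) `&`
   [set z | eps * inner z.1 z.1 <= `|inner (transversal z.1) (tnth z.2 a)|])); last first.
  apply/seteqP; split => z.
    by move=> [a [h1 h2 h3]]; exists a => //; split; [split => // b _; exact: h2|exact: h3].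
  by move=> [a _ [[h1 h2] h3]]; exists a; split => // b; exact: h2.
apply: fin_bigcup_measurable => [|a _]; first exact: finite_finset.
apply: measurableI; first apply: measurableI.
- by apply: measurable_set_lt => //; exact: measurable_inner.
- apply: fin_bigcap_measurable => [|b _]; first exact: finite_finset.
  by apply: measurable_set_le; exact: measurable_inner.
- apply: measurable_set_le.
    by apply: measurable_funM => //; exact: measurable_inner.
  apply: measurableT_comp => //.
  rewrite (_ : (fun z : n.-tuple R * codebook => _) = fun z =>
     inner z.1 z.1 * inner theta (tnth z.2 a) - inner theta z.1 * inner z.1 (tnth z.2 a)).
    by apply: measurable_funB; apply: measurable_funM; exact: measurable_inner.
  by apply/funext => z; rewrite !inner_simp.
Qed.

End bad_events.

Section bad_events_probability.
Context {R : realType} {n N : nat} (nu : probability (n.-tuple R) R).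
Hypothesis nu_unif : uniform_sphere_law nu.
Variable mu : probability (N.-tuple (n.-tuple R)) R.
Hypothesis mu_nu : product_law (fun=> nu) mu.
Variables (i j : 'I_n) (theta x : n.-tuple R).
Hypothesis ij : i != j.

Lemma measurable_bad_winner (eta : R) : measurable (@bad_winner R n N i j eta).
Proof.
have mcoord a k : measurable_fun setT (fun xx : N.-tuple (n.-tuple R) => tnth (tnth xx a) k).
  exact: (measurableT_comp (@measurable_tnth _ _ _ k) (@measurable_tnth _ _ _ a)).
apply: measurableI; first exact: measurable_spherical.
rewrite [X in measurable X](_ : _ = \bigcup_(a in [set: 'I_N])
  ([set xx | 0 < tnth (tnth xx a) i] `&`
   (\bigcap_(b in [set: 'I_N]) [set xx | tnth (tnth xx b) i <= tnth (tnth xx a) i]) `&`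
   [set xx | eta <= `|tnth (tnth xx a) j|])); last first.
  apply/seteqP; split => xx.
    by move=> [a [h1 h2 h3]]; exists a => //; split; [split => // b _; exact: h2|exact: h3].
  by move=> [a _ [[h1 h2] h3]]; exists a; split => // b; exact: h2.
apply: fin_bigcup_measurable => [|a _]; first exact: finite_finset.
apply: measurableI; first apply: measurableI.
- exact: measurable_set_lt.
- apply: fin_bigcap_measurable => [|b _]; first exact: finite_finset.
  exact: measurable_set_le.
- by apply: measurable_set_le => //; exact: measurableT_comp.
Qed.

(** Rotate [x] to the axis [i] and its transversal to the axis [j]; the event becomes a bad winner.
    At x = 0 it is empty, because a positive inner product is required. *)
Lemma transversal_event_bound (eps : R) : 0 < eps ->
  (mu (xsection (transversal_event theta eps) x) <=
    ((enorm theta + 1) ^+ 2 / (n.-1%:R * eps ^+ 2))%:E)%E.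
Proof.
move=> e0; have th0 := enorm_ge0 theta; have th1 : 0 < enorm theta + 1 by lra.
have [x0|x0] := eqVneq (inner x x) 0.
  have -> : xsection (transversal_event theta eps) x = set0 :> set (N.-tuple (n.-tuple R)).
    rewrite -subset0 => xx; rewrite /xsection/= inE => -[_ [a [/= xa _ _]]].
    by move: xa; rewrite /inner big1 ?ltxx// => k _; rewrite (inner_eq0 x0) mul0r.
  rewrite measure0 lee_fin; apply: divr_ge0; first exact: sqr_ge0.
  by apply: mulr_ge0 => //; exact: sqr_ge0.
have [Q Q0 [Qx Qw]] := rotation_to_frame ij x0 (inner_transversal theta x).
have xp : 0 < enorm x.
  by rewrite lt_def enorm_ge0 andbT; apply: contra x0 => /eqP e; rewrite -enorm_sqr e expr0n.
(* The added 1 keeps the quotient meaningful when theta = 0. *)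
pose eta := eps / (enorm theta + 1).
have eta0 : 0 < eta by rewrite divr_gt0.
have mb := measurable_bad_winner eta.
apply: (@le_trans _ _ (mu (rotate_codebook Q @^-1` bad_winner i j eta))).
  apply: le_measure; rewrite ?inE.
  - by apply: measurable_xsection; exact: measurable_transversal_event.
  - by rewrite -[X in measurable X]setTI; exact: measurable_rotate_codebook.
  move=> xx; rewrite /xsection/= inE => -[/= sp [a [xa amax aeps]]].
  have xE b : inner x (tnth xx b) = enorm x * tnth (tnth (rotate_codebook Q xx) b) i.
    by rewrite -(inner_mxact _ _ Q0) Qx inner_vscalel inner_ebasel (tnth_mktuple _ b).
  have wE b : inner (transversal theta x) (tnth xx b) =
      enorm (transversal theta x) * tnth (tnth (rotate_codebook Q xx) b) j.
    by rewrite -(inner_mxact _ _ Q0) Qw inner_vscalel inner_ebasel (tnth_mktuple _ b).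
  split; first by move=> b; rewrite (tnth_mktuple _ b) unit_sphere_mxact.
  exists a; split.
  - by rewrite -(pmulr_rgt0 _ xp) -xE.
  - by move=> b; rewrite -(ler_pM2l xp) -!xE.
  - rewrite ler_pdivrMr//; move: aeps; rewrite wE normrM (ger0_norm (enorm_ge0 _)) => h.
    have xx0 : 0 < inner x x by rewrite lt_def x0 inner_ge0.
    rewrite -(ler_pM2r xx0); apply: le_trans h _.
    rewrite mulrC -mulrA ler_wpM2l//.
    apply: le_trans (enorm_transversal _ _) _; rewrite mulrC ler_wpM2r ?inner_ge0//; lra.
rewrite (codebook_rotation nu_unif mu_nu)//.
apply: le_trans (bad_winner_bound nu_unif mu_nu ij eta0 mb) _.
rewrite lee_fin /eta expr_div_n le_eqVlt; apply/orP; left; apply/eqP.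
by rewrite invfM invf_div [in RHS]invfM mulrCA.
Qed.

Lemma low_correlation_event_bound (t p : R) :
  (p%:E <= nu [set y | (t <= tnth y i)%R])%E ->
  (mu (xsection (low_correlation_event t) x) <= (expR (- (N%:R * p)))%:E)%E.
Proof.
(* An empty codebook makes the event sure, and the bound is then 1. With a codeword, x = 0 makes it
   empty. *)
move=> tp; case: N mu mu_nu => [|N'] m m_nu.
  by rewrite mul0r oppr0 expR0; apply: probability_le1; apply: measurable_xsection;
    exact: measurable_low_correlation_event.
have mB : measurable (box (fun=> [set y | tnth y i < t] : set (n.-tuple R)) : set (N'.+1.-tuple _)).
  apply: measurable_box => a.
  by apply: (@measurable_set_lt _ _ R _ (fun=> t)) => //; exact: measurable_tnth.
have [x0|x0] := eqVneq (inner x x) 0.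
  have -> : xsection (low_correlation_event t) x = set0 :> set (N'.+1.-tuple (n.-tuple R)).
    rewrite -subset0 => xx; rewrite /xsection/= inE => /(_ ord0)/=.
    rewrite /enorm x0 sqrtr0 mulr0 /inner big1 ?ltxx// => k _.
    by rewrite (inner_eq0 x0) mul0r.
  by rewrite measure0 lee_fin expR_ge0.
have xz : inner x (vscale 0 x) = 0 by rewrite inner_vscaler mul0r.
have [Q Q0 [Qx _]] := rotation_to_frame ij x0 xz.
have xp : 0 < enorm x.
  by rewrite lt_def enorm_ge0 andbT; apply: contra x0 => /eqP e; rewrite -enorm_sqr e expr0n.
apply: le_trans (codebook_all_below m_nu tp).
rewrite -(codebook_rotation nu_unif m_nu Q0 mB); apply: le_measure; rewrite ?inE.
- by apply: measurable_xsection; exact: measurable_low_correlation_event.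
- by rewrite -[X in measurable X]setTI; exact: measurable_rotate_codebook.
move=> xx; rewrite /xsection/= inE => h a; have := h a => /=.
rewrite -(inner_mxact _ _ Q0) Qx inner_vscalel inner_ebasel (tnth_mktuple _ a).
by rewrite mulrC ltr_pM2r.
Qed.

End bad_events_probability.

(** * The error on the good event *)

Section shrinkage.
Context {R : realType} (sigma : R).
Hypothesis sigma0 : 0 < sigma.

(** The decoder scales the codeword by sqrt n * sqrt (1 - 2^{-2B}) * [shrink] of the quantized
    squared norm; [shrink (b ^+ 2)] is also the limit of <theta, X> / (sqrt n |X|). *)
Definition shrink (u : R) := u / Num.sqrt (u + sigma ^+ 2).

Let sqrt_ge u : 0 <= u -> sigma <= Num.sqrt (u + sigma ^+ 2).
Proof.
move=> u0; rewrite -[leLHS](gtr0_norm sigma0) -sqrtr_sqr ler_sqrt ?lerDr//.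
by rewrite addr_ge0// sqr_ge0.
Qed.

Lemma shrink_ge0 u : 0 <= u -> 0 <= shrink u.
Proof. by move=> u0; rewrite divr_ge0// sqrtr_ge0. Qed.

(** [shrink] is increasing, so replacing the denominator of the larger value by the smaller one only
    enlarges the difference; both denominators are at least [sigma]. *)
Lemma shrink_lipschitz_le u v : 0 <= v <= u -> `|shrink u - shrink v| <= (u - v) / sigma.
Proof.
move=> /andP[v0 vu]; have u0 := le_trans v0 vu; have s0 := sigma0.
have su := sqrt_ge u0; have sv := sqrt_ge v0.
set a := Num.sqrt (u + _) in su; set c := Num.sqrt (v + _) in sv.
have a2 : a ^+ 2 = u + sigma ^+ 2 by rewrite sqr_sqrtr// addr_ge0// sqr_ge0.
have c2 : c ^+ 2 = v + sigma ^+ 2 by rewrite sqr_sqrtr// addr_ge0// sqr_ge0.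
have a0 : 0 < a by lra.
have c0 : 0 < c by lra.
have ca : c <= a by rewrite -(ler_pXn2r (n:=2)) ?nnegrE ?(ltW a0) ?(ltW c0)// a2 c2; lra.
have mono : v / c <= u / a.
  rewrite ler_pdivrMr// mulrAC ler_pdivlMr//.
  rewrite (_ : v = c ^+ 2 - sigma ^+ 2); last lra.
  rewrite (_ : u = a ^+ 2 - sigma ^+ 2); last lra.
  have : 0 <= (a - c) * (a * c + sigma ^+ 2).
    by rewrite mulr_ge0 ?subr_ge0// addr_ge0 ?sqr_ge0 ?mulr_ge0 ?ltW.
  nra.
rewrite /shrink -/a -/c ger0_norm ?subr_ge0//.
apply: (@le_trans _ _ (u / c - v / c)).
  rewrite lerD2r ler_wpM2l// lef_pV2 ?posrE//.
by rewrite -mulrBl ler_wpM2l ?subr_ge0// lef_pV2 ?posrE.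
Qed.

Lemma shrink_lipschitz u v : 0 <= u -> 0 <= v -> `|shrink u - shrink v| <= `|u - v| / sigma.
Proof.
move=> u0 v0; have [uv|vu] := leP u v.
- rewrite distrC (distrC u) [X in _ <= X / _]ger0_norm ?subr_ge0//.
  by apply: shrink_lipschitz_le; rewrite u0.
- rewrite [X in _ <= X / _]ger0_norm ?subr_ge0 ?(ltW vu)//.
  by apply: shrink_lipschitz_le; rewrite v0 ltW.
Qed.

End shrinkage.

(* [A], [ip], [bc], [e] stand for |x|^2/n, <theta,x>/n, the quantized squared
   norm and <theta,v>/sqrt n, with v the selected codeword; s = <x,v>/|x| and
   g is the contribution to e of the component of theta orthogonal to x. *)
Lemma squared_error_bound {R : realType} (sigma b beta C1 lam A ip bc s g e a : R) :
  0 < sigma -> 0 <= b -> 0 <= beta <= 1 -> 0 <= C1 -> 0 < lam <= 1 ->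
  4 * lam <= sigma ^+ 2 -> 0 <= s <= 1 -> 0 <= bc ->
  b ^+ 2 - lam <= ip -> `|A - (b ^+ 2 + sigma ^+ 2)| <= 3 * lam ->
  `|bc - b ^+ 2| <= 7 * lam -> beta - C1 * lam <= s -> `|g| <= lam ->
  e = s * (ip / Num.sqrt A) + g -> a = beta * shrink sigma bc ->
  b ^+ 2 + a ^+ 2 - 2 * a * e <=
    b ^+ 2 - beta ^+ 2 * shrink sigma (b ^+ 2) ^+ 2 +
    (49 / sigma ^+ 2 + 2 * (b + 7 / sigma) * (C1 * b + 8 / sigma + 1)) * lam.
Proof.
move=> s0 b0 /andP[be0 be1] C10 /andP[l0 l1] ls /andP[sp s1] bc0 ipl Al bcl sl gl eE aE.
pose tau := Num.sqrt (b ^+ 2 + sigma ^+ 2).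
have b20 : 0 <= b ^+ 2 by exact: sqr_ge0.
have s20 : 0 < sigma ^+ 2 by rewrite exprn_gt0.
have tau2 : tau ^+ 2 = b ^+ 2 + sigma ^+ 2 by rewrite sqr_sqrtr// addr_ge0// ltW.
have tau0 : 0 < tau by rewrite sqrtr_gt0 ltr_wpDl.
have taus : sigma <= tau.
  by rewrite -(ler_pXn2r (n:=2)) ?nnegrE ?(ltW s0) ?(ltW tau0)// tau2; lra.
have taub : b <= tau.
  by rewrite -(ler_pXn2r (n:=2)) ?nnegrE ?(ltW tau0)// tau2; lra.
move: Al; rewrite ler_norml -tau2 => /andP[Al Au].
pose rho := Num.sqrt A.
have A0 : 0 < A by nra.
have rho2 : rho ^+ 2 = A by rewrite sqr_sqrtr// ltW.
have rho0 : 0 < rho by rewrite sqrtr_gt0.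
(* 4 lam <= sigma^2 <= tau^2, so A >= tau^2 - 3 lam is at least a quarter of tau^2. *)
have rhot : tau <= 2 * rho.
  rewrite -(ler_pXn2r (n:=2)) ?nnegrE ?(ltW tau0) ?mulr_ge0 ?(ltW rho0)//.
  by rewrite exprMn rho2; nra.
pose ys := shrink sigma (b ^+ 2).
have ysE : ys = b ^+ 2 / tau by [].
have ys0 : 0 <= ys by exact: shrink_ge0.
have ysb : ys <= b by rewrite ysE ler_pdivrMr//; nra.
have rt : rho - tau <= 3 * lam / tau.
  rewrite ler_pdivlMr//.
  have : (rho - tau) * (rho + tau) <= 3 * lam by rewrite -subr_sqr rho2; lra.
  have [le|lt] := leP rho tau; nra.
(* A deviation of 4 lam, one from [ip] and three from [A], divided by rho >= sigma / 2. *)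
have y_lb : ys - 8 / sigma * lam <= ip / rho.
  rewrite ler_pdivlMr//.
  have h1 : ys * rho <= b ^+ 2 + 3 * lam.
    have : ys * (rho - tau) <= ys * (3 * lam / tau) by rewrite ler_wpM2l.
    have -> : ys * (3 * lam / tau) = ys / tau * (3 * lam) by ring.
    have : ys / tau <= 1 by rewrite ler_pdivrMr// mul1r; lra.
    have : ys * tau = b ^+ 2 by rewrite ysE divfK// gt_eqF.
    have : 0 <= 3 * lam by lra.
    move: (ys / tau) => q; nra.
  have h2 : 4 * lam <= 8 / sigma * lam * rho.
    rewrite (_ : _ * rho = 4 * lam * (2 * rho / sigma)); last by field; rewrite gt_eqF.
    by rewrite ler_peMr ?ler_pdivlMr//; lra.
  lra.
pose C2 := 8 / sigma; have C20 : 0 < C2 by rewrite divr_gt0.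
pose C3 := C1 * b + C2 + 1.
have e_lb : beta * ys - C3 * lam <= e.
  have h1 : s * (ys - C2 * lam) <= s * (ip / rho) by rewrite ler_wpM2l.
  have h2 : - lam <= g by move: gl; rewrite ler_norml => /andP[].
  have h3 : (beta - C1 * lam) * ys <= s * ys by rewrite ler_wpM2r.
  have h4 : s * (C2 * lam) <= C2 * lam by rewrite ler_piMl// mulr_ge0// ltW.
  have h5 : C1 * lam * ys <= C1 * lam * b by rewrite ler_wpM2l// mulr_ge0// ltW.
  rewrite eE -/rho /C3; lra.
have ab : `|a - beta * ys| <= 7 / sigma * lam.
  rewrite aE -mulrBr normrM (ger0_norm be0).
  have := shrink_lipschitz s0 bc0 b20; rewrite -/ys => h.
  apply: (@le_trans _ _ (`|shrink sigma bc - ys|)); first by rewrite ler_piMl.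
  apply: le_trans h _; rewrite ler_pdivrMr// (_ : _ * sigma = 7 * lam)//.
  by field; rewrite gt_eqF.
have a0 : 0 <= a by rewrite aE mulr_ge0 ?shrink_ge0.
have a_ub : a <= b + 7 / sigma.
  have h1 : beta * ys <= b by apply: le_trans ysb; rewrite ler_piMl.
  have h2 : 7 / sigma * lam <= 7 / sigma by rewrite ler_piMr// divr_ge0// ltW.
  by move: ab; rewrite ler_norml => /andP[_]; lra.
(* Completing the square: a^2 - 2 a e = - (beta ys)^2 + (a - beta ys)^2 + 2 a (beta ys - e). The
   last two terms give the two summands of the constant. *)
have sq : (a - beta * ys) ^+ 2 <= 49 / sigma ^+ 2 * lam.
  rewrite -real_normK ?num_real//.
  apply: (@le_trans _ _ ((7 / sigma * lam) ^+ 2)).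
    by rewrite ler_pXn2r// nnegrE// ?(le_trans _ ab)// normr_ge0.
  rewrite (_ : _ ^+ 2 = 49 / sigma ^+ 2 * lam * lam); last by field; rewrite gt_eqF.
  by rewrite ler_piMr// mulr_ge0 ?divr_ge0// ltW.
have C30 : 0 < C3.
  by have : 0 <= C1 * b; [exact: mulr_ge0|rewrite /C3; lra].
have h1 : a * (beta * ys - C3 * lam) <= a * e by rewrite ler_wpM2l.
have h2 : a * (C3 * lam) <= (b + 7 / sigma) * (C3 * lam) by rewrite ler_wpM2r// mulr_ge0// ltW.
rewrite -/C2 -/C3 -/ys; move: sq h1 h2; lra.
Qed.

Section quantized_estimate_error.
Context {R : realType}.

(** Since b2 <= c^2, some grid point is within 1 / sqrt n of [b2]; comparing with it through [t]
    counts the error of [t] twice. *)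
Lemma scalar_encoding_error n (c b2 t beta : R) : (0 < n)%N -> 0 < c ->
  0 <= b2 <= c ^+ 2 -> scalar_encoding (scalar_codebook n c) t beta ->
  0 < beta /\ `|beta - b2| <= 2 * `|t - b2| + (Num.sqrt n%:R)^-1.
Proof.
move=> n0 c0 /andP[b0 bc] [[k [k0 _] <-] kmin].
have r0 : 0 < Num.sqrt n%:R :> R by rewrite sqrtr_gt0 ltr0n.
split; first by rewrite divr_gt0// ltr0n.
set r := Num.sqrt n%:R in r0 kmin *; pose m := Num.ceil (c ^+ 2 * r).
pose y := b2 * r; have y0 : 0 <= y by rewrite mulr_ge0// ltW.
have m0 : 0 < m by rewrite ceil_gt0 mulr_gt0// exprn_gt0.
have ym : y <= m%:~R.
  by apply: le_trans (ceil_ge _); rewrite ler_wpM2r// ltW.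
have /andP[ty yt] := truncn_itv y0.
(* Rounding up avoids the index 0, absent from the grid; when that exceeds the last index [m],
   rounding down is safe because [m] is positive. *)
have [l [l0 lm ly]] : exists l : nat, [/\ (0 < l)%N, l%:Z <= m & `|l%:R - y| <= 1].
  have [tm|mt] := leP ((Num.truncn y).+1%:Z) m.
    exists (Num.truncn y).+1; split => //.
    by rewrite ger0_norm ?subr_ge0 ?(ltW yt)// -natr1; lra.
  exists (Num.truncn y); split.
  - by move: mt m0; lia.
  - by rewrite -(ler_int R) (le_trans _ ym).
  - by rewrite distrC ger0_norm ?subr_ge0//; move: yt; rewrite -natr1; lra.
have gb : `|l%:R / r - b2| <= r^-1.
  rewrite (_ : l%:R / r - b2 = (l%:R - y) / r); last by rewrite mulrBl mulfK// gt_eqF.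
  by rewrite normrM [`|r^-1|]gtr0_norm ?invr_gt0// ler_piMl// invr_ge0 ltW.
have gt := kmin (l%:R / r) (ex_intro2 _ _ l (conj l0 lm) erefl).
have h1 : `|k%:R / r - b2| <= `|k%:R / r - t| + `|t - b2| by exact: ler_distD.
have h2 : `|l%:R / r - t| <= `|l%:R / r - b2| + `|b2 - t| by exact: ler_distD.
by move: h2; rewrite (distrC b2); lra.
Qed.

Lemma dist_vscale n (theta v : n.-tuple R) (alpha : R) : inner v v = 1 ->
  dist theta (vscale alpha v) =
  n%:R^-1 * (inner theta theta - 2 * alpha * inner theta v + alpha ^+ 2).
Proof.
move=> v1; rewrite /dist enorm_sqr !inner_simp v1 (innerC v theta); congr (_ * _); ring.
Qed.

Definition error_constant (sigma b C1 : R) : R :=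
  49 / sigma ^+ 2 + 2 * (b + 7 / sigma) * (C1 * b + 8 / sigma + 1).

(** A deterministic statement: the random inputs enter only through the complements of the bad
    events. *)
Lemma estimate_error n N (sigma B b c C1 lam t : R) (theta x m : n.-tuple R)
    (xx : N.-tuple (n.-tuple R)) :
  (0 < n)%N -> 0 < sigma -> 0 <= B -> 0 <= b <= c -> 0 < c -> 0 <= C1 ->
  0 < lam <= 1 -> 4 * lam <= sigma ^+ 2 -> (Num.sqrt n%:R)^-1 <= lam ->
  enorm theta ^+ 2 / n%:R = b ^+ 2 ->
  `|inner theta (vsub x theta)| < n%:R * lam ->
  `|inner (vsub x theta) (vsub x theta) - n%:R * sigma ^+ 2| < n%:R * lam ->
  0 < t -> Num.sqrt (1 - 2 `^ (- (2 * B))) - C1 * lam <= t ->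
  spherical xx -> ~ low_correlation_event t (x, xx) ->
  ~ transversal_event theta (Num.sqrt n%:R * lam) (x, xx) ->
  quantized_estimate B sigma c xx x m ->
  dist theta m <= sigma ^+ 2 * b ^+ 2 / (sigma ^+ 2 + b ^+ 2)
     + b ^+ 4 / (sigma ^+ 2 + b ^+ 2) * 2 `^ (- (2 * B))
     + error_constant sigma b C1 * lam.
Proof.
move=> n0 s0 B0 /andP[b0 bc] c0 C10 /andP[l0 l1] ls nl thb A1 A2 t0 tl sp nlow ntr.
move=> [bch [j [Hs Hv ->]]].
set q := 2 `^ _ in tl *.
have q0 : 0 < q by rewrite powR_gt0.
have q1 : q <= 1.
  by rewrite -[leRHS](powRr0 2) ler_powR ?ler1n// oppr_le0 mulr_ge0.
pose N_ : R := n%:R; have N0 : 0 < N_ by rewrite ltr0n.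
pose r := Num.sqrt N_; have r0 : 0 < r by rewrite sqrtr_gt0.
have rr : r ^+ 2 = N_ by rewrite sqr_sqrtr// ltW.
have s2 : 0 < sigma ^+ 2 by rewrite exprn_gt0.
have b20 : 0 <= b ^+ 2 by exact: sqr_ge0.
have thE : inner theta theta = N_ * b ^+ 2.
  by rewrite -thb enorm_sqr mulrC divfK// gt_eqF.
pose A := inner x x / N_; pose ip := inner theta x / N_.
have xxE : inner x x = inner theta theta + 2 * inner theta (vsub x theta) +
    inner (vsub x theta) (vsub x theta).
  by rewrite !inner_simp (innerC x theta); ring.
have ipE : ip = b ^+ 2 + inner theta (vsub x theta) / N_.
  by rewrite /ip inner_vsubr thE; field; rewrite gt_eqF.
have AE : A - (b ^+ 2 + sigma ^+ 2) = 2 * (inner theta (vsub x theta) / N_) +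
    (inner (vsub x theta) (vsub x theta) - N_ * sigma ^+ 2) / N_.
  by rewrite /A xxE thE; field; rewrite gt_eqF.
have norm_div (z : R) : `|z| < N_ * lam -> `|z / N_| <= lam.
  move=> zl; rewrite normrM (gtr0_norm (_ : 0 < N_^-1)) ?invr_gt0//.
  by rewrite ler_pdivrMr// mulrC ltW.
have {}A1 := norm_div _ A1; have {}A2 := norm_div _ A2.
have ip_lb : b ^+ 2 - lam <= ip.
  by rewrite ipE; move: A1; rewrite ler_norml => /andP[? _]; lra.
have A_near : `|A - (b ^+ 2 + sigma ^+ 2)| <= 3 * lam.
  rewrite AE; apply: le_trans (ler_normD _ _) _.
  rewrite normrM (ger0_norm (_ : 0 <= 2 :> R))//; lra.
have A0 : 0 < A by move: A_near; rewrite ler_norml => /andP[? _]; lra.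
have x0 : 0 < inner x x by rewrite -(pmulr_lgt0 _ (_ : 0 < N_^-1)) ?invr_gt0.
have ex : enorm x = r * Num.sqrt A.
  rewrite -sqrtrM ?(ltW N0)// /enorm /A mulrCA divff ?mulr1// gt_eqF//.
have ex0 : 0 < enorm x by rewrite sqrtr_gt0.
have b2c : 0 <= b ^+ 2 <= c ^+ 2 by rewrite b20 lerXn2r// nnegrE ltW.
have [bch0 bchE] := scalar_encoding_error n0 c0 b2c Hs.
(* 7 = 2 * 3 + 1: twice the error of the norm estimate plus the grid spacing. *)
have bch_near : `|bch - b ^+ 2| <= 7 * lam.
  have : `|bhat2 sigma x - b ^+ 2| <= 3 * lam.
    rewrite /bhat2 enorm_sqr mulrC -/N_ -/A; apply: le_trans A_near.
    by rewrite le_eqVlt; apply/orP; left; apply/eqP; congr `|_|; ring.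
  by move: bchE; rewrite -/N_ -/r; move: nl; rewrite -/N_ -/r; lra.
pose v := tnth xx j; have v1 : inner v v = 1 by apply/unit_sphere_inner; exact: sp.
have [a xa] : exists a : 'I_N, t * enorm x <= inner x (tnth xx a).
  apply: contrapT => h; apply: nlow => a /=; rewrite ltNge; apply/negP => xa.
  by apply: h; exists a.
have xv : t * enorm x <= inner x v by apply: le_trans xa (Hv a).
have xv0 : 0 < inner x v by apply: lt_le_trans xv; rewrite mulr_gt0.
pose s := inner x v / enorm x.
have s0' : 0 <= s by rewrite divr_ge0// ltW.
have s1 : s <= 1.
  rewrite ler_pdivrMr// mul1r -(ler_pXn2r (n:=2)) ?nnegrE ?(ltW xv0) ?(ltW ex0)//.
  by rewrite enorm_sqr (le_trans (cauchy_schwarz _ _))// v1 mulr1.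
have ts : t <= s by rewrite ler_pdivlMr.
pose g := inner (transversal theta x) v / (inner x x * r).
have g_le : `|g| <= lam.
  rewrite normrM (gtr0_norm (_ : 0 < (inner x x * r)^-1)) ?invr_gt0 ?mulr_gt0//.
  rewrite ler_pdivrMr ?mulr_gt0// leNgt; apply/negP => h; apply: ntr.
  split => //; exists j; split => //=.
  by rewrite -/N_ -/r -/v (ltW (le_lt_trans _ h))// le_eqVlt; apply/orP; left; apply/eqP; ring.
(* Decomposition of theta along and across [x], paired with [v]. *)
have eE : inner theta v / r = s * (ip / Num.sqrt A) + g.
  have AA : inner x x = N_ * A by rewrite /A mulrCA divff ?mulr1// gt_eqF.
  have sA : Num.sqrt A ^+ 2 = A by rewrite sqr_sqrtr// ltW.
  have : 0 < Num.sqrt A by rewrite sqrtr_gt0.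
  rewrite /g /transversal !inner_simp /s ex /ip AA.
  move: (Num.sqrt A) sA => ra <- ra0; rewrite -rr.
  by field; rewrite !gt_eqF.
have be01 : 0 <= Num.sqrt (1 - q) <= 1.
  by rewrite sqrtr_ge0 -[X in _ <= X]sqrtr1 ler_sqrt//; lra.
have be2 : Num.sqrt (1 - q) ^+ 2 = 1 - q by rewrite sqr_sqrtr// subr_ge0.
have D0 : 0 < bch + sigma ^+ 2 by rewrite addr_gt0.
have key := squared_error_bound s0 b0 be01 C10 (_ : 0 < lam <= 1) ls
  (_ : 0 <= s <= 1) (ltW bch0) ip_lb A_near bch_near (le_trans tl ts) g_le eE erefl.
have {}key := key ltac:(by rewrite l0) ltac:(by rewrite s0').
set e := inner theta v / r in key; set a0 := _ * shrink _ _ in key.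
have alphaE : Num.sqrt (n%:R * bch ^+ 2 * (1 - q) / (bch + sigma ^+ 2)) = r * a0.
  have ra0 : 0 <= r * a0 by rewrite /a0 !mulr_ge0 ?shrink_ge0 ?sqrtr_ge0// ltW.
  rewrite -[RHS](ger0_norm ra0) -sqrtr_sqr; congr Num.sqrt.
  rewrite /a0 /shrink !exprMn exprVn (sqr_sqrtr (ltW D0)) be2 rr -/N_.
  by ring.
rewrite /Defs.decode -/q alphaE dist_vscale// -/v thE -/N_.
have -> : N_^-1 * (N_ * b ^+ 2 - 2 * (r * a0) * inner theta v + (r * a0) ^+ 2) =
    b ^+ 2 + a0 ^+ 2 - 2 * a0 * e.
  by rewrite /e exprMn -rr; field; rewrite gt_eqF.
apply: le_trans key _; rewrite lerD2r be2 le_eqVlt; apply/orP; left; apply/eqP.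
have E0 : 0 < sigma ^+ 2 + b ^+ 2 by rewrite ltr_pwDl.
rewrite /shrink expr_div_n sqr_sqrtr; last by rewrite addr_ge0// ltW.
by rewrite (addrC (b ^+ 2)); field; rewrite gt_eqF.
Qed.

End quantized_estimate_error.

(** * Convergence in probability *)

Lemma measurable_dist {R : realType} n (theta : n.-tuple R) :
  measurable_fun setT (fun m : n.-tuple R => dist theta m).
Proof.
have E : (fun m : n.-tuple R => dist theta m) =
    fun m => n%:R^-1 * (inner theta theta - 2 * inner theta m + inner m m).
  apply/funext => m; rewrite /dist enorm_sqr !inner_simp (innerC m theta).
  by congr (_ * _); ring.
rewrite E; apply: measurable_funM => //; apply: measurable_funD; last exact: measurable_inner.
apply: measurable_funB => //; apply: measurable_funM => //; exact: measurable_inner.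
Qed.

(** At rate 0 the decoder's factor 1 - 2^{-2B} vanishes and the estimate is the zero vector. *)
Lemma dist_zero_rate {R : realType} n (sigma b c : R) N (theta x m : n.-tuple R)
    (xx : N.-tuple (n.-tuple R)) : 0 < sigma -> enorm theta ^+ 2 / n%:R = b ^+ 2 ->
  quantized_estimate 0 sigma c xx x m -> dist theta m = b ^+ 2.
Proof.
move=> s0 thb [bch [j [_ _ ->]]].
rewrite /Defs.decode mulr0 oppr0 powRr0 subrr mulr0 mul0r sqrtr0.
by rewrite /dist enorm_sqr !inner_simp !mul0r !subr0 -enorm_sqr mulrC.
Qed.

Section one_sample_size.
Context {R : realType} (sigma B b c Cc c0 : R) (n : nat).
Hypotheses (s0 : 0 < sigma) (B0 : 0 <= B) (b0 : 0 <= b) (cp : 0 < c) (bc : b <= c).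
Hypotheses (Cc0 : 0 < Cc) (c00 : 0 < c0) (n2 : (1 < n)%N).
Variable theta : n.-tuple R.
Hypothesis theta_b : enorm theta ^+ 2 / n%:R = b ^+ 2.
Context {d : measure_display} {T : measurableType d} {P : probability T R}.
Variables (X : {RV P >-> n.-tuple R})
  (XX : {RV P >-> (codebook_size n B).-tuple (n.-tuple R)}) (M : {RV P >-> n.-tuple R}).
Hypothesis X_law : gaussian_law theta sigma (distribution P X).
Variable nu : probability (n.-tuple R) R.
Hypotheses (nu_unif : uniform_sphere_law nu).
Hypothesis XX_law : product_law (fun=> nu) (distribution P XX).
Hypothesis ind : independent_rv X XX.
Hypothesis M_est : forall w, quantized_estimate B sigma c (XX w) (X w) (M w).

Local Notation lam := (Num.sqrt (ln n%:R / n%:R) : R).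
Local Notation t := (Num.sqrt (1 - 2 `^ (- (2 * B))) - Cc / Num.sqrt n%:R).

Hypotheses (ln1 : 1 <= ln (n%:R : R)) (lam_small : 4 * lam <= sigma ^+ 2) (t0 : 0 < t).
Variables (p : R) (i0 : 'I_n).
Hypothesis p_cap : (p%:E <= nu [set x | (t <= tnth x i0)%R])%E.
Hypothesis p_large : c0 * n%:R <= (codebook_size n B)%:R * p.

Lemma excess_error_probability :
  (P [set w | (sigma ^+ 2 * b ^+ 2 / (sigma ^+ 2 + b ^+ 2)
         + b ^+ 4 / (sigma ^+ 2 + b ^+ 2) * 2 `^ (- (2 * B))
         + error_constant sigma b Cc * lam < dist theta (M w))%R] <=
  ((sigma ^+ 2 * b ^+ 2 + 65 * sigma ^+ 4 + c0^-1 + 2 * (b + 1) ^+ 2) / ln n%:R)%:E)%E.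
Proof.
pose x : R := n%:R; have x2 : 2 <= x by rewrite ler_nat.
have x0 : 0 < x by lra.
pose L := ln x; have L1 : 1 <= L by exact: ln1.
have L0 : 0 < L by lra.
have lnx : L <= x.
  by rewrite -ler_expR lnK ?posrE//; apply: le_trans (expR_ge1Dx _); lra.
have lam2 : lam ^+ 2 = L / x by rewrite sqr_sqrtr// divr_ge0// ltW.
have lam0 : 0 < lam by rewrite sqrtr_gt0 divr_gt0.
have lam1 : lam <= 1.
  by rewrite -[leRHS]sqrtr1 ler_sqrt// ler_pdivrMr// mul1r.
have rx : Num.sqrt x ^+ 2 = x by rewrite sqr_sqrtr// ltW.
have rl : (Num.sqrt x)^-1 <= lam.
  rewrite -sqrtrV ?(ltW x0)// ler_sqrt; last by rewrite divr_ge0// ltW.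
  by rewrite ler_peMl// invr_ge0 ltW.
have thE : enorm theta ^+ 2 = x * b ^+ 2 by rewrite -theta_b mulrC divfK// gt_eqF.
pose A1 := [set y : n.-tuple R | x * lam <= `|inner theta (vsub y theta)|].
pose A2 := [set y : n.-tuple R |
  x * lam <= `|inner (vsub y theta) (vsub y theta) - x * sigma ^+ 2|].
pose A3 := [set w | low_correlation_event t (X w, XX w)].
pose A4 := [set w | transversal_event theta (Num.sqrt x * lam) (X w, XX w)].
pose A5 := [set w | (~` spherical) (XX w)].
have xl0 : 0 < x * lam by rewrite mulr_gt0.
have xl2 : (x * lam) ^+ 2 = x * L by rewrite exprMn lam2; field; rewrite gt_eqF.
have P1 : (P (X @^-1` A1) <= (sigma ^+ 2 * b ^+ 2 / L)%:E)%E.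
  apply: le_trans (gaussian_inner_chebyshev s0 X_law xl0) _.
  rewrite lee_fin xl2 thE le_eqVlt; apply/orP; left; apply/eqP; field.
  by rewrite !gt_eqF.
have P2 : (P (X @^-1` A2) <= (65 * sigma ^+ 4 / L)%:E)%E.
  apply: le_trans (gaussian_norm_chebyshev s0 X_law xl0) _.
  rewrite lee_fin xl2 -/x le_eqVlt; apply/orP; left; apply/eqP; field.
  by rewrite !gt_eqF.
have [i [j ij]] : exists i j : 'I_n, i != j.
  by exists (Ordinal (ltnW n2)), (Ordinal n2); rewrite -val_eqE.
have [i1 i01] : exists i1 : 'I_n, i0 != i1.
  have [e|ne] := eqVneq i0 i; last by exists i.
  by exists j; rewrite e.
have P3 : (P A3 <= (c0^-1 / L)%:E)%E.
  apply: (independent_rv_bound (E := low_correlation_event t)) => //.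
    exact: measurable_low_correlation_event.
  move=> y; apply: le_trans (low_correlation_event_bound nu_unif XX_law y i01 p_cap) _.
  rewrite lee_fin expRN -invfM lef_pV2 ?posrE ?expR_gt0 ?mulr_gt0//.
  (* The exponentially small bound is weakened to 1 / (c0 ln n), the common order of the other
     terms. *)
  apply: (@le_trans _ _ (c0 * x)); first by rewrite ler_pM2l.
  apply: le_trans p_large _; apply: le_trans (expR_ge1Dx _); lra.
have P4 : (P A4 <= (2 * (b + 1) ^+ 2 / L)%:E)%E.
  apply: (independent_rv_bound (E := transversal_event theta (Num.sqrt x * lam))) => //.
    exact: measurable_transversal_event.
  move=> y; apply: le_trans (transversal_event_bound nu_unif XX_law theta y ij _) _.
    by rewrite mulr_gt0// sqrtr_gt0.
  rewrite lee_fin exprMn rx lam2 (_ : x * (L / x) = L); last by field; rewrite gt_eqF.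
  have n1 : n.-1%:R = x - 1 :> R by rewrite /x -[in RHS](prednK (ltnW n2)) -natr1 addrK.
  rewrite n1 invfM mulrA ler_wpM2r ?invr_ge0 ?(ltW L0)//.
  rewrite ler_pdivrMr; last lra.
  have thr : enorm theta = Num.sqrt x * b.
    rewrite -[LHS]ger0_norm ?enorm_ge0// -sqrtr_sqr thE sqrtrM ?(ltW x0)//.
    by rewrite sqrtr_sqr ger0_norm.
  have r1 : 1 <= Num.sqrt x by rewrite -[leLHS]sqrtr1 ler_sqrt//; lra.
  (* |theta| + 1 <= sqrt n (b + 1); then n / (n - 1) <= 2 gives the factor 2. *)
  apply: (@le_trans _ _ ((Num.sqrt x * (b + 1)) ^+ 2)).
    rewrite thr; apply: lerXn2r; rewrite ?nnegrE; last by lra.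
    - by rewrite addr_ge0// mulr_ge0// sqrtr_ge0.
    - by rewrite mulr_ge0 ?sqrtr_ge0// addr_ge0.
  rewrite exprMn rx; have := sqr_ge0 (b + 1); move: ((b + 1) ^+ 2) => w w0.
  have : 0 <= w * (x - 2) by rewrite mulr_ge0//; lra.
  lra.
have P5 : P A5 = 0%E by exact: (spherical_ae nu_unif XX_law).
have mpre (A : set (n.-tuple R)) : measurable A -> measurable (X @^-1` A).
  by move=> mA; rewrite -[X in measurable X]setTI; exact: measurable_funPT.
have mpair (A : set (n.-tuple R * (codebook_size n B).-tuple (n.-tuple R))) :
    measurable A -> measurable [set w | A (X w, XX w)].
  move=> mA; have := measurable_RV_pair X XX measurableT mA.
  by rewrite setTI.
have mA1 : measurable (X @^-1` A1).
  apply: mpre; apply: measurable_set_le => //; apply: measurableT_comp => //.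
  have -> : (fun y => inner theta (vsub y theta)) = (fun y => inner theta y - inner theta theta).
    by apply/funext => y; rewrite inner_vsubr.
  by apply: measurable_funB => //; exact: measurable_inner.
have mA2 : measurable (X @^-1` A2).
  apply: mpre; apply: measurable_set_le => //; apply: measurableT_comp => //.
  have -> : (fun y => inner (vsub y theta) (vsub y theta) - x * sigma ^+ 2) =
      (fun y => inner y y - 2 * inner theta y + (inner theta theta - x * sigma ^+ 2)).
    by apply/funext => y; rewrite !inner_simp (innerC y theta); ring.
  apply: measurable_funD => //; apply: measurable_funB; first exact: measurable_inner.
  by apply: measurable_funM => //; exact: measurable_inner.
have mA3 : measurable A3 by apply: mpair; exact: measurable_low_correlation_event.
have mA4 : measurable A4 by apply: mpair; exact: measurable_transversal_event.
have mA5 : measurable A5.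
  rewrite -[X in measurable X]setTI; apply: measurable_funPT => //.
  by apply: measurableC; exact: measurable_spherical.
set E := (X in P X).
have mE : measurable E.
  apply: measurable_set_lt => //; apply: measurableT_comp => //.
  exact: measurable_dist.
have sub : E `<=` X @^-1` A1 `|` X @^-1` A2 `|` A3 `|` A4 `|` A5.
  move=> w Ew; apply: contrapT.
  move=> /not_orP[/not_orP[/not_orP[/not_orP[/negP n1 /negP n2'] n3] n4] n5].
  move: Ew; rewrite /E/= ltNge => /negP; apply.
  apply: (@estimate_error R n _ sigma B b c Cc lam t theta (X w) (M w) (XX w)) => //.
  - exact: ltnW.
  - by rewrite b0.
  - exact: ltW.
  - by rewrite lam0.
  - by rewrite ltNge.
  - by rewrite ltNge.
  - by rewrite lerD2l lerN2 ler_wpM2l// ltW.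
  - exact: contrapT n5.
apply: (@le_trans _ _ (P (X @^-1` A1) + P (X @^-1` A2) + P A3 + P A4 + P A5)%E).
  apply: (@le_trans _ _ (P (X @^-1` A1 `|` X @^-1` A2 `|` A3 `|` A4 `|` A5))).
    by apply: le_measure; rewrite ?inE//; do !apply: measurableU.
  do 4 (apply: le_trans (measureU2 _ _ _) _; rewrite ?leeD2r//; do ?apply: measurableU => //).
rewrite P5 adde0; apply: le_trans (leeD (leeD (leeD P1 P2) P3) P4) _.
by rewrite -!EFinD lee_fin -!mulrDl.
Qed.

End one_sample_size.

Lemma near_ln_ge (R : realType) (K : R) : \forall n \near \oo, K <= ln n%:R.
Proof.
near=> n; have n0 : 0 < n%:R :> R by rewrite ltr0n; near: n; exact: nbhs_infty_gt.
rewrite -ler_expR lnK ?posrE//; near: n; exact: nbhs_infty_ger.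
Unshelve. all: by end_near. Qed.

Lemma near_ln_div_small (R : realType) (e : R) : 0 < e ->
  \forall n \near \oo, Num.sqrt (ln n%:R / n%:R) <= e.
Proof.
move=> e0; near=> n.
have n0 : 0 < n%:R :> R by rewrite ltr0n; near: n; exact: nbhs_infty_gt.
have l0 : 0 <= ln n%:R :> R by near: n; exact: near_ln_ge.
rewrite -(ler_pXn2r (n:=2)) ?nnegrE ?sqrtr_ge0 ?(ltW e0)//.
rewrite sqr_sqrtr ?divr_ge0 ?(ltW n0)// ler_pdivrMr//.
have h : ln n%:R <= 2 * Num.sqrt n%:R :> R.
  have -> : ln n%:R = 2 * ln (Num.sqrt n%:R) :> R.
    by rewrite -[in LHS](sqr_sqrtr (ltW n0)) lnXn ?sqrtr_gt0// mulr_natl.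
  rewrite ler_pM2l// -ler_expR lnK ?posrE ?sqrtr_gt0//.
  by apply: le_trans (expR_ge1Dx _); lra.
apply: le_trans h _.
have r_ge : 2 / e ^+ 2 <= Num.sqrt n%:R by near: n; exact: near_sqrt_ge.
rewrite -[in leRHS](sqr_sqrtr (ltW n0)) expr2 mulrA ler_wpM2r ?sqrtr_ge0//.
by rewrite -expr2 [leRHS]mulrC -ler_pdivrMr ?exprn_gt0.
Unshelve. all: by end_near. Qed.

Lemma cvg_div_ln (R : realType) (K : R) : (K / ln n%:R)%:E @[n --> \oo] --> (0 : \bar R).
Proof.
have h : (ln n%:R : R)^-1 @[n --> \oo] --> (0 : R).
  apply/gtr0_cvgV0; last by apply/cvgryPge => M; exact: near_ln_ge.
  near=> n; apply: (@lt_le_trans _ _ 1) => //; near: n; exact: near_ln_ge.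
apply: cvg_EFin; first by near=> n.
rewrite [X in _ --> X](_ : _ = K * 0); last by rewrite mulr0.
exact: cvgMr.
Unshelve. all: by end_near. Qed.

Theorem theorem3p2 (R : realType) (sigma B b : R) :
  0 < sigma -> 0 <= B -> 0 <= b ->
  exists C : R,
  forall (c : R), 0 < c -> b <= c ->
  forall (theta : forall n : nat, n.-tuple R),
  (forall n : nat, (0 < n)%N -> enorm (theta n) ^+ 2 / n%:R = b ^+ 2) ->
  forall (d : nat -> measure_display) (T : forall n : nat, measurableType (d n))
    (P : forall n : nat, probability (T n) R)
    (X : forall n : nat, {RV (P n) >-> n.-tuple R})
    (XX : forall n : nat,
       {RV (P n) >-> (codebook_size n B).-tuple (n.-tuple R)})
    (M : forall n : nat, {RV (P n) >-> n.-tuple R}),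
  (forall n : nat, (0 < n)%N ->
     [/\ gaussian_law (theta n) sigma (distribution (P n) (X n)),
         codebook_law (distribution (P n) (XX n)),
         independent_rv (X n) (XX n)
       & forall w : T n,
           quantized_estimate B sigma c (XX n w) (X n w) (M n w)]) ->
  P n [set w : T n |
         sigma ^+ 2 * b ^+ 2 / (sigma ^+ 2 + b ^+ 2)
         + b ^+ 4 / (sigma ^+ 2 + b ^+ 2) * 2 `^ (- (2 * B))
         + C * Num.sqrt (ln n%:R / n%:R)
         < dist (theta n) (M n w)] @[n --> \oo] --> (0 : \bar R).
Proof.
move=> s0 B0 b0; have s2 : 0 < sigma ^+ 2 by rewrite exprn_gt0.
(* At B = 0 the error equals b^2, which is exactly the target, so the event is empty for n > 0 with
   C = 0. *)
have [->|Bn0] := eqVneq B 0.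
  exists 0 => c c0 bc theta thb d T P X XX M H.
  apply: cvg_near_cst; near=> n.
  have n0 : (0 < n)%N by near: n; exact: nbhs_infty_gt.
  have [_ _ _ Mest] := H n n0.
  rewrite (_ : [set w | _] = set0) ?measure0// -subset0 => w /=.
  rewrite (dist_zero_rate s0 (thb n n0) (Mest w)) mulr0 oppr0 powRr0 mulr1 mul0r addr0.
  rewrite (_ : _ + _ = b ^+ 2) ?ltxx//; field.
  by rewrite gt_eqF// ltr_pwDl// sqr_ge0.
have Bp : 0 < B by rewrite lt_def Bn0.
have [Cc [c0 [Cc0 c00 Hcap]]] := cap_mass_asymptotics Bp.
(* [Cc] depends on [B] only, so the constant is chosen before [c] and [theta]. *)
exists (error_constant sigma b Cc) => c cp bc theta thb d T P X XX M H.
pose K := sigma ^+ 2 * b ^+ 2 + 65 * sigma ^+ 4 + c0^-1 + 2 * (b + 1) ^+ 2.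
apply: (squeeze_cvge (f := fun=> 0%E) (h := fun n => (K / ln n%:R)%:E)).
- near=> n; rewrite measure_ge0/=.
  have n2 : (1 < n)%N by near: n; exact: nbhs_infty_gt.
  have ln1 : 1 <= ln n%:R :> R by near: n; exact: near_ln_ge.
  have lams : 4 * Num.sqrt (ln n%:R / n%:R) <= sigma ^+ 2.
    rewrite mulrC -ler_pdivlMr//; near: n; apply: near_ln_div_small.
    by rewrite divr_gt0.
  have [Xl [nu nu_unif XXl] ind Mest] := H n (ltnW n2).
  have cap : forall nu : probability (n.-tuple R) R, uniform_sphere_law nu ->
      forall i : 'I_n,
      let t := Num.sqrt (1 - 2 `^ (- (2 * B))) - Cc / Num.sqrt n%:R in
      0 < t /\ exists p : R, (p%:E <= nu [set x | (t <= tnth x i)%R])%E /\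
        c0 * n%:R <= (codebook_size n B)%:R * p by near: n.
  have [t0 [p [p1 p2]]] := cap nu nu_unif (Ordinal n2).
  exact: (excess_error_probability s0 B0 b0 cp bc Cc0 c00 n2 (thb n (ltnW n2))
    Xl nu_unif XXl ind Mest ln1 lams t0 p1 p2).
- exact: cvg_cst.
- exact: cvg_div_ln.
Unshelve. all: by end_near. Qed.
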